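(* There exist an absolute constant $C\ge 1$, a constant $\kappa_*>0$ and a function $\varphi:(0,\infty)\to(0,\infty)$ such that the following holds whenever $0<\kappa_3\le\kappa_*$, $0<\kappa_2\le\varphi(\kappa_3)$ and $0<\kappa_1\le\varphi(\kappa_2)$. Let $\beta\in\mathbb{R}$ be such that $\beta$ and $\beta^2$ are both irrational and non-Liouville, and let $\mu\ge 1$ be an upper bound for the irrationality exponents of $\beta$ and $\beta^2$. There is $X_0=X_0(\beta,\mu,\kappa_1,\kappa_2,\kappa_3)$ such that for all real $X\ge X_0$ and all $\theta\in\mathbb{R}$, setting $\delta_i=X^{-\kappa_i/\mu}$ for $i=1,2,3$: (i) Either $$\left|\mathbb{E}_{n\in[X]}e(-\theta n\lfloor\beta n\rfloor)\right|\le C\delta_1^{1/2},$$ or $$\theta=\frac aq+t\qquad(\ast)$$ for some integers $a,q$ with $1\le q\le C\delta_1^{-C}$ and some real $t$ with $|t|\le C\delta_2^{-C}X^{-2}$. (ii) Whenever $\theta$ is of the form $(\ast)$, with $a,q,t$ satisfying the stated bounds and with $\gcd(a,q)=1$, $$\left|\mathbb{E}_{n\in[X]}e(-\theta n\lfloor\beta n\rfloor)-\frac{1}{qX}\int_0^X e(-\beta v^2t)\,\mathrm{d}v\right|\le C\delta_2^{-C}\delta_3^{1/2}.$$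
   Context: $e(x)=e^{2\pi i x}$; $\lfloor x\rfloor$ is the greatest integer $\le x$; $[X]=\{n\in\mathbb{Z}:1\le n\le X\}$; $\mathbb{E}_{n\in S}f(n)=|S|^{-1}\sum_{n\in S}f(n)$. A real number $\beta$ is non-Liouville if there exist $m>0$ and $M\ge 1$ such that $0<|\beta-a/q|<m/q^M$ has no solutions in integers $a,q$ with $q\ge1$; the infimum of such $M$ is the irrationality exponent of $\beta$. *)

(* Defs.v *)
From Stdlib Require Import Reals ZArith.
From Coquelicot Require Import Coquelicot.
Open Scope R_scope.

(* e(x) = exp (2 pi i x), by Euler's formula. *)
Definition e (x : R) : C := (cos (2 * PI * x), sin (2 * PI * x)).

(* The average of [f] over the integers n with 1 <= n <= X.  There are
   [Zfloor X] of them when X >= 0; the value is 0 if there are none. *)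
Definition mean (X : R) (f : nat -> C) : C :=
  let N := Z.to_nat (Zfloor X) in
  (RtoC (/ INR N) * sum_n_m f 1 N)%C.

Definition irrational (b : R) : Prop :=
  ~ exists a q : Z, q <> 0%Z /\ b = IZR a / IZR q.

Definition admissible_exponent (b M : R) : Prop :=
  1 <= M /\
  exists m : R, 0 < m /\
    ~ exists a q : Z, (1 <= q)%Z /\
        0 < Rabs (b - IZR a / IZR q) < m / Rpower (IZR q) M.

Definition non_Liouville (b : R) : Prop :=
  exists M : R, admissible_exponent b M.

(* An infimum in the extended reals, hence +oo when [b] is Liouville. *)
Definition irrationality_exponent (b : R) : Rbar :=
  Glb_Rbar (admissible_exponent b).

Definition exp_mean (theta beta X : R) : C :=
  mean X (fun n => e (- theta * INR n * IZR (Zfloor (beta * INR n)))).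

(* The integral of a complex-valued function of a real variable: C is taken
   here as a normed module over R, which is not its default structure. *)
Definition CInt (f : R -> C) (a b : R) : C :=
  RInt (V := C_R_CompleteNormedModule) f a b.

Definition major_arc (K delta1 delta2 X theta : R) (a q : Z) (t : R) : Prop :=
  theta = IZR a / IZR q + t /\
  (1 <= q)%Z /\ IZR q <= K * Rpower delta1 (- K) /\
  Rabs t <= K * Rpower delta2 (- K) * / X ^ 2.

(* Main.v *)
Require Import Defs.
From Stdlib Require Import Reals ZArith Lra Lia Psatz List Permutation Classical.
From Coquelicot Require Import Coquelicot.
Open Scope R_scope.

(* Write F(n) = e(-theta n floor(beta n)).  If beta s is close to an integer P,
   then floor(beta (n + s)) = floor(beta n) + P for most n, so shifting n by s
   replaces F(n) by e(-theta (n + s) (floor(beta n) + P)) on average.  Apply this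
   with (s, P) = a v1 + b v2, where v1, v2 is a basis of Z^2 reduced with respect
   to the quadratic form (h / X)^2 + (h beta - p)^2 and a, b range over a box.

   If theta = c / q + t is on a major arc, take 0 <= a, b < q: since v1, v2 is a
   basis, the pairs (n + s, floor(beta n) + P) run over all of (Z/q)^2, and the
   complete sum of e(-c x y / q) is exactly q.

   If the mean of F is large, take the largest box on which the shifts are
   harmless.  Weyl differencing, in the form of a bilinear estimate in pairs of
   shifts along (v1, v1), (v1, v2) and (v2, v2), shows that for some small integer
   j the form j theta x y is close to an integral form u x^2 + v x y + w y^2 on
   that box.  Comparing coefficients gives u ~ w beta^2 with w small, so u = w = 0
   because beta^2 is not Liouville, and then j theta is within O(X^-2) of v, up to
   small powers of X. *)

(** * Finite sums *)

(** Two short directions are needed: one shift vector would see a single coefficient of the form and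
    could not cover (Z/q)^2. Reduction gives lengths with r1 r2 X <= 2, so v2 is short only if r1 X
    is bounded below. This is where the exponent of beta enters: an exceptionally good approximation
    to beta would make v1 too short and v2 too long. The same input makes the first coordinate h1 of
    v1 large, and p1 / h1 is then the approximation to beta that bounds the number of n with beta n
    near an integer, the n at which a shift may disturb the floor.

    Everything is measured in Y = X^(1/mu), so that delta_i = Y^(-k_i) and the savings are fixed
    powers of Y: r2 <= 2 Y^(-1/4), and apart from a term proportional to the shift error the
    exceptional n have density O(Y^(-1/5)). The losses from g = Y^(-k1/2) and from q are Y^O(k1)
    with k1 <= 1/1000, and constants depending on beta are absorbed by small powers of Y. The
    Diophantine bounds are used with exponent 2 mu because the infimum in the irrationality exponent
    need not be attained. *)

Definition Csum {T : Type} (l : list T) (f : T -> C) : C :=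
  fold_right (fun x s => (f x + s)%C) 0 l.

Definition Rsum {T : Type} (l : list T) (f : T -> R) : R :=
  fold_right (fun x s => f x + s) 0 l.

Definition count {T : Type} (P : T -> bool) (l : list T) : R :=
  INR (length (filter P l)).

Lemma Csum_cons {T} (x : T) l f : Csum (x :: l) f = (f x + Csum l f)%C.
Proof. reflexivity. Qed.

Lemma Csum_ext {T} (l : list T) f g :
  (forall x, In x l -> f x = g x) -> Csum l f = Csum l g.
Proof.
  induction l as [|x l IH]; intros H; [reflexivity|].
  rewrite !Csum_cons, (H x), IH; simpl; auto.
  intros y Hy; apply H; simpl; auto.
Qed.

Lemma Csum_app {T} (l l' : list T) f : Csum (l ++ l') f = (Csum l f + Csum l' f)%C.
Proof.
  induction l as [|x l IH]; simpl app; [unfold Csum at 2; simpl; ring|].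
  rewrite !Csum_cons, IH; ring.
Qed.

Lemma Csum_seq_S (f : nat -> C) (m n : nat) :
  Csum (seq m (S n)) f = (Csum (seq m n) f + f (m + n)%nat)%C.
Proof. rewrite seq_S, Csum_app, Csum_cons. unfold Csum at 2; simpl. ring. Qed.

Lemma Csum_map {T U} (l : list T) (g : T -> U) f :
  Csum (map g l) f = Csum l (fun x => f (g x)).
Proof. induction l as [|x l IH]; [reflexivity|]. simpl map. rewrite !Csum_cons, IH; reflexivity. Qed.

Lemma Csum_perm {T} (l l' : list T) f : Permutation l l' -> Csum l f = Csum l' f.
Proof.
  induction 1; rewrite ?Csum_cons; try congruence; ring.
Qed.

Lemma Csum_plus {T} (l : list T) f g :
  Csum l (fun x => (f x + g x)%C) = (Csum l f + Csum l g)%C.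
Proof.
  induction l as [|x l IH]; [unfold Csum; simpl; ring|].
  rewrite !Csum_cons, IH; ring.
Qed.

Lemma Csum_scal {T} (l : list T) f (c : C) :
  Csum l (fun x => (c * f x)%C) = (c * Csum l f)%C.
Proof.
  induction l as [|x l IH]; [unfold Csum; simpl; ring|].
  rewrite !Csum_cons, IH; ring.
Qed.

Lemma Csum_minus {T} (l : list T) f g :
  Csum l (fun x => (f x - g x)%C) = (Csum l f - Csum l g)%C.
Proof.
  induction l as [|x l IH]; [unfold Csum; simpl; ring|].
  rewrite !Csum_cons, IH; ring.
Qed.

Lemma Csum_const {T} (l : list T) (c : C) :
  Csum l (fun _ => c) = (INR (length l) * c)%C.
Proof.
  induction l as [|x l IH]; [unfold Csum; simpl; ring|].
  rewrite Csum_cons, IH. cbn [length]. rewrite S_INR, RtoC_plus. ring.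
Qed.

Lemma Csum_0 {T} (l : list T) : Csum l (fun _ => 0) = 0.
Proof. rewrite Csum_const; ring. Qed.

Lemma Csum_exchange {T U} (l : list T) (l' : list U) f :
  Csum l (fun x => Csum l' (fun y => f x y)) = Csum l' (fun y => Csum l (fun x => f x y)).
Proof.
  induction l as [|x l IH].
  - symmetry; apply Csum_0.
  - rewrite Csum_cons, IH, <- Csum_plus. apply Csum_ext; intros; reflexivity.
Qed.

Lemma Csum_list_prod {T U} (l : list T) (l' : list U) f :
  Csum (list_prod l l') f = Csum l (fun x => Csum l' (fun y => f (x, y))).
Proof.
  induction l as [|x l IH]; [reflexivity|].
  simpl list_prod. rewrite Csum_app, Csum_map, IH; reflexivity.
Qed.

Lemma Csum_conj {T} (l : list T) f : Cconj (Csum l f) = Csum l (fun x => Cconj (f x)).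
Proof.
  induction l as [|x l IH].
  - unfold Csum; simpl. unfold Cconj; simpl. now rewrite Ropp_0.
  - rewrite !Csum_cons, Cplus_conj, IH; reflexivity.
Qed.

Lemma Rsum_cons {T} (x : T) l f : Rsum (x :: l) f = f x + Rsum l f.
Proof. reflexivity. Qed.

Lemma Rsum_le {T} (l : list T) f g :
  (forall x, In x l -> f x <= g x) -> Rsum l f <= Rsum l g.
Proof.
  induction l as [|x l IH]; intros H; [unfold Rsum; simpl; lra|].
  rewrite !Rsum_cons. apply Rplus_le_compat; [apply H; simpl; auto|].
  apply IH; intros; apply H; simpl; auto.
Qed.

Lemma Rsum_const {T} (l : list T) c : Rsum l (fun _ => c) = INR (length l) * c.
Proof.
  induction l as [|x l IH]; [unfold Rsum; simpl; ring|].
  rewrite Rsum_cons, IH. cbn [length]. rewrite S_INR; ring.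
Qed.

Lemma Csum_RtoC {T} (l : list T) f : Csum l (fun x => RtoC (f x)) = RtoC (Rsum l f).
Proof.
  induction l as [|x l IH]; [reflexivity|].
  rewrite Csum_cons, Rsum_cons, IH, RtoC_plus; reflexivity.
Qed.

Lemma Cmod_Csum_le {T} (l : list T) f : Cmod (Csum l f) <= Rsum l (fun x => Cmod (f x)).
Proof.
  induction l as [|x l IH]; [unfold Csum, Rsum; simpl; rewrite Cmod_0; lra|].
  rewrite Csum_cons, Rsum_cons. eapply Rle_trans; [apply Cmod_triangle|lra].
Qed.

Lemma Cmod_Csum_le_const {T} (l : list T) f c :
  (forall x, In x l -> Cmod (f x) <= c) -> Cmod (Csum l f) <= INR (length l) * c.
Proof.
  intros H. eapply Rle_trans; [apply Cmod_Csum_le|].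
  rewrite <- Rsum_const. apply Rsum_le, H.
Qed.

Lemma count_cons {T} (P : T -> bool) x l :
  count P (x :: l) = (if P x then 1 else 0) + count P l.
Proof.
  unfold count; simpl. destruct (P x); cbn [length]; rewrite ?S_INR; ring.
Qed.

Lemma count_app {T} (P : T -> bool) l l' : count P (l ++ l') = count P l + count P l'.
Proof. unfold count. rewrite filter_app, length_app, plus_INR; reflexivity. Qed.

Lemma count_ge0 {T} (P : T -> bool) l : 0 <= count P l.
Proof. apply pos_INR. Qed.

(** Exceptional sets are discarded in this form: [P] marks the exceptions, and the common bound [c]
    is charged to them as well, which is harmless since [0 <= c]. *)
Lemma Rsum_le_count {T} (P : T -> bool) (l : list T) f c c' :
  0 <= c ->
  (forall x, In x l -> P x = false -> f x <= c) ->
  (forall x, In x l -> f x <= c') ->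
  Rsum l f <= INR (length l) * c + count P l * c'.
Proof.
  intros Hc. induction l as [|x l IH]; intros H H'.
  - unfold Rsum, count; simpl; lra.
  - rewrite Rsum_cons, count_cons. cbn [length]. rewrite S_INR.
    assert (IH' := IH (fun y Hy => H y (or_intror Hy)) (fun y Hy => H' y (or_intror Hy))).
    destruct (P x) eqn:E.
    + specialize (H' x (or_introl eq_refl)). lra.
    + specialize (H x (or_introl eq_refl) E). lra.
Qed.

Lemma Cauchy_Schwarz_Rsum {T} (l : list T) f :
  (Rsum l f) ^ 2 <= INR (length l) * Rsum l (fun x => f x ^ 2).
Proof.
  induction l as [|x l IH]; [unfold Rsum; simpl; lra|].
  rewrite !Rsum_cons. cbn [length]. rewrite S_INR.
  set (S := Rsum l f) in *. set (Q := Rsum l (fun x => f x ^ 2)) in *. set (B := INR _) in *.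
  assert (HB : 0 <= B) by apply pos_INR.
  assert (HQ : 0 <= Q).
  { replace 0 with (INR (length l) * 0) by ring. rewrite <- Rsum_const.
    apply Rsum_le. intros; apply pow2_ge_0. }
  enough (2 * S * f x <= Q + B * f x ^ 2) by nra.
  (* An empty tail has S = 0. Otherwise multiply by B: since S^2 <= B Q, the claim follows from 0 <=
     (S - B f x)^2. *)
  destruct (Req_dec B 0) as [E|E].
  - assert (S = 0) by (rewrite E in IH; nra). subst S; rewrite H, E; nra.
  - assert (0 <= (S - B * f x) ^ 2) by apply pow2_ge_0.
    apply Rmult_le_reg_l with B; [lra|]. nra.
Qed.

(** * The exponential e(x) and the distance to the nearest integer *)

Lemma e_plus x y : e (x + y) = (e x * e y)%C.
Proof.
  unfold e, Cmult; simpl. rewrite Rmult_plus_distr_l, cos_plus, sin_plus.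
  f_equal; ring.
Qed.

Lemma e_0 : e 0 = 1.
Proof. unfold e. rewrite Rmult_0_r, cos_0, sin_0; reflexivity. Qed.

Lemma e_INR n : e (INR n) = 1.
Proof.
  unfold e. replace (2 * PI * INR n) with (0 + 2 * INR n * PI) by ring.
  rewrite cos_period, sin_period, cos_0, sin_0; reflexivity.
Qed.

Lemma Cmod_e x : Cmod (e x) = 1.
Proof.
  transitivity (sqrt 1); [|apply sqrt_1]. unfold e, Cmod; simpl. f_equal.
  generalize (sin2_cos2 (2 * PI * x)). unfold Rsqr. intros. rewrite !Rmult_1_r. lra.
Qed.

Lemma e_conj x : Cconj (e x) = e (- x).
Proof.
  unfold e, Cconj; simpl.
  replace (2 * PI * - x) with (- (2 * PI * x)) by ring.
  rewrite cos_neg, sin_neg; reflexivity.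
Qed.

Lemma e_IZR z : e (IZR z) = 1.
Proof.
  destruct (Z_le_gt_dec 0 z) as [H|H].
  - rewrite <- (Z2Nat.id z), <- INR_IZR_INZ by lia. apply e_INR.
  - replace (IZR z) with (- INR (Z.to_nat (- z))).
    2:{ rewrite INR_IZR_INZ, Z2Nat.id, opp_IZR by lia; lra. }
    rewrite <- e_conj, e_INR. unfold Cconj; simpl. now rewrite Ropp_0.
Qed.

Lemma e_shift x z : e (x + IZR z) = e x.
Proof. rewrite e_plus, e_IZR; ring. Qed.

Lemma Cmod_e_minus_1 x : Cmod (e x - 1) = 2 * Rabs (sin (PI * x)).
Proof.
  unfold e, Cmod, Cminus, Cplus, Copp; simpl.
  set (s := sin (PI * x)).
  replace (2 * PI * x) with (2 * (PI * x)) by ring.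
  rewrite cos_2a_sin, sin_2a. fold s.
  assert (H := sin2_cos2 (PI * x)). fold s in H. unfold Rsqr in H.
  set (c := cos (PI * x)) in *.
  replace (2 * Rabs s) with (Rabs (2 * s)) by (rewrite Rabs_mult, (Rabs_pos_eq 2); lra).
  rewrite <- sqrt_Rsqr_abs.
  f_equal. unfold Rsqr.
  replace (2 * s * (2 * s)) with (4 * (s * s) * (s * s) + 4 * (s * s) * (1 - s * s)) by ring.
  replace (1 - s * s) with (c * c) by lra. ring.
Qed.

Lemma abs_sin_le x : Rabs (sin x) <= Rabs x.
Proof.
  assert (P : forall y, 0 <= y -> Rabs (sin y) <= y).
  { intros y Hy. destruct (Rle_lt_dec y 1).
    - assert (HP := PI2_1). destruct (Req_dec y 0) as [->|].
      + rewrite sin_0, Rabs_R0; lra.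
      + rewrite Rabs_pos_eq by (apply sin_ge_0; lra). left; apply sin_lt_x; lra.
    - apply Rle_trans with 1; [|lra]. apply Rabs_le, SIN_bound. }
  destruct (Rle_lt_dec 0 x).
  - rewrite (Rabs_pos_eq x) by lra. auto.
  - rewrite (Rabs_left x) by lra. rewrite <- Rabs_Ropp, <- sin_neg. apply P; lra.
Qed.

(** The sharp constant 2 pi is rounded up to 8 by [PI_4]. *)
Lemma e_lipschitz x y : Cmod (e x - e y) <= 8 * Rabs (x - y).
Proof.
  replace (e x - e y)%C with (e y * (e (x - y) - 1))%C.
  2:{ replace x with (y + (x - y)) at 2 by ring. rewrite e_plus; ring. }
  rewrite Cmod_mult, Cmod_e, Cmod_e_minus_1, Rmult_1_l.
  assert (H := abs_sin_le (PI * (x - y))). rewrite Rabs_mult, (Rabs_pos_eq PI) in H.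
  2: left; apply PI_RGT_0.
  assert (H4 := PI_4). assert (H0 := Rabs_pos (x - y)). nra.
Qed.

Definition dist_int (x : R) : R := Rabs (x - IZR (Zfloor (x + / 2))).

Lemma dist_int_ge0 x : 0 <= dist_int x.
Proof. apply Rabs_pos. Qed.

Lemma dist_int_half x : dist_int x <= / 2.
Proof.
  unfold dist_int. generalize (Zfloor_bound (x + / 2)). intros. apply Rabs_le; lra.
Qed.

Lemma dist_int_le x z : dist_int x <= Rabs (x - IZR z).
Proof.
  assert (H := dist_int_half x). unfold dist_int in *.
  set (w := Zfloor (x + / 2)) in *.
  destruct (Z.eq_dec z w) as [->|N]; [lra|].
  assert (Hz : 1 <= Rabs (IZR w - IZR z)).
  { rewrite <- minus_IZR, <- abs_IZR. apply IZR_le. lia. }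
  assert (T := Rabs_triang (IZR w - x) (x - IZR z)).
  replace (IZR w - x + (x - IZR z)) with (IZR w - IZR z) in T by ring.
  rewrite (Rabs_minus_sym (IZR w) x) in T. lra.
Qed.

Definition near_int (rho x : R) : bool := if Rle_dec (dist_int x) rho then true else false.

(** A weak Jordan inequality. The cubic Taylor bound suffices up to 1.7, where x^2 <= 3. Only pi <=
    4 is used, so x may seem to reach 2; past 1.7 monotonicity and the value at 1.7 are enough. *)
Lemma sin_ge_third x : 0 <= x <= PI / 2 -> x / 3 <= sin x.
Proof.
  intros H. assert (H4 := PI_4).
  assert (A : forall y, 0 <= y <= 4 -> y - y ^ 3 / 6 <= sin y).
  { intros y Hy. replace (y - y ^ 3 / 6) with (sin_approx y (2 * 0 + 1)).
    - apply pre_sin_bound; lra.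
    - unfold sin_approx, sin_term; simpl; field. }
  destruct (Rle_lt_dec x 1.7) as [L|L].
  - assert (B := A x ltac:(lra)). assert (x * x <= 3) by nra. nra.
  - assert (sin 1.7 <= sin x) by (apply sin_incr_1; lra).
    assert (B := A 1.7 ltac:(lra)).
    lra.
Qed.

(** The best constant is 4; the factor 2 is what remains of 2 |sin (pi y)| >= 2 pi |y| / 3 after pi
    >= 3. *)
Lemma Cmod_e_minus_1_ge x : 2 * dist_int x <= Cmod (e x - 1).
Proof.
  set (z := Zfloor (x + / 2)). set (y := x - IZR z).
  assert (Hy : Rabs y = dist_int x) by reflexivity.
  assert (Hh := dist_int_half x).
  replace (e x) with (e y).
  2:{ unfold y. rewrite <- (e_shift (x - IZR z) z). f_equal; ring. }
  rewrite Cmod_e_minus_1.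
  assert (HP := PI_RGT_0). assert (HP2 := PI2_3_2).
  assert (HS : Rabs (PI * y) / 3 <= Rabs (sin (PI * y))).
  { rewrite Rabs_mult, (Rabs_pos_eq PI) by lra.
    assert (G : PI * Rabs y / 3 <= sin (PI * Rabs y)).
    { apply sin_ge_third. split; [apply Rmult_le_pos; [lra|apply Rabs_pos]|nra]. }
    destruct (Rle_lt_dec 0 y).
    - rewrite (Rabs_pos_eq y) in G |- * by lra.
      eapply Rle_trans; [exact G|apply Rle_abs].
    - rewrite (Rabs_left y) in G |- * by lra.
      replace (PI * - y) with (- (PI * y)) in G |- * by ring.
      rewrite sin_neg in G. rewrite <- Rabs_Ropp.
      eapply Rle_trans; [exact G|apply Rle_abs]. }
  rewrite Rabs_mult, (Rabs_pos_eq PI) in HS by lra. assert (0 <= Rabs y) by apply Rabs_pos. nra.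
Qed.

Lemma geometric_sum xi (n : nat) :
  ((e xi - 1) * Csum (seq 0 n) (fun b => e (xi * INR b)) = e (xi * INR n) - 1)%C.
Proof.
  induction n as [|n IH].
  - simpl. rewrite Rmult_0_r, e_0. unfold Csum; simpl; ring.
  - rewrite Csum_seq_S, Nat.add_0_l, Cmult_plus_distr_l, IH, S_INR, Rmult_plus_distr_l, e_plus, Rmult_1_r. ring.
Qed.

Lemma geometric_sum_le (xi rho : R) (B : nat) : 0 < rho -> rho <= dist_int xi ->
  Cmod (Csum (seq 0 B) (fun b => e (xi * INR b))) <= 1 / rho.
Proof.
  intros Hr H. assert (L := Cmod_e_minus_1_ge xi).
  assert (U : Cmod (e (xi * INR B) - 1) <= 2).
  { eapply Rle_trans; [apply Cmod_triangle|]. rewrite Cmod_opp, Cmod_e, Cmod_1. lra. }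
  rewrite <- geometric_sum, Cmod_mult in U. apply Rmult_le_reg_l with rho; [lra|].
  replace (rho * (1 / rho)) with 1 by (field; lra).
  assert (0 <= Cmod (Csum (seq 0 B) (fun b => e (xi * INR b)))) by apply Cmod_ge_0.
  nra.
Qed.

(** * Counting the terms of an arithmetic progression that lie near integers *)

Lemma Z_interval_length (l : list Z) (c w : R) : 0 <= w -> NoDup l ->
  (forall z, In z l -> Rabs (IZR z - c) <= w) -> INR (length l) <= 2 * w + 1.
Proof.
  intros Hw ND H.
  (* [lo] is the ceiling of c - w, so every entry of the list lies between [lo] and [hi]. *)
  set (lo := (- Zfloor (- (c - w)))%Z). set (hi := Zfloor (c + w)).
  set (n := Z.to_nat (hi - lo + 1)).
  assert (B1 := Zfloor_bound (- (c - w))). assert (B2 := Zfloor_bound (c + w)).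
  assert (I : incl l (map (fun k => (lo + Z.of_nat k)%Z) (seq 0 n))).
  { intros z Hz. specialize (H z Hz). apply Rabs_le_between' in H.
    assert (z <= hi)%Z by (apply Zfloor_lub; lra).
    assert (- z <= Zfloor (- (c - w)))%Z by (apply Zfloor_lub; rewrite opp_IZR; lra).
    apply in_map_iff. exists (Z.to_nat (z - lo)). split; [unfold lo in *; lia|].
    apply in_seq. unfold n, lo in *; lia. }
  apply NoDup_incl_length in I; [|assumption].
  rewrite length_map, length_seq in I.
  apply le_INR in I. eapply Rle_trans; [exact I|].
  rewrite INR_IZR_INZ. unfold n.
  destruct (Z_le_gt_dec 0 (hi - lo + 1)).
  - rewrite Z2Nat.id, plus_IZR, minus_IZR by lia. unfold lo, hi. rewrite opp_IZR. lra.
  - replace (Z.to_nat _) with 0%nat by lia. simpl; lra.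
Qed.

Lemma NoDup_map_in {T U} (f : T -> U) (l : list T) :
  NoDup l -> (forall x y, In x l -> In y l -> f x = f y -> x = y) -> NoDup (map f l).
Proof.
  intros N H. apply NoDup_map_NoDup_ForallPairs; [|assumption].
  intros x y Hx Hy. apply H; assumption.
Qed.

(* For [h] in a block of [j] consecutive integers, if [z] is the integer
   nearest to [xi h + s] then [l h - j z] determines [h] and lies in an
   interval of length [2 (rho j + 1)]. *)
Lemma count_near_block (xi s rho : R) (j l : Z) (h0 : nat) :
  (1 <= j)%Z -> Z.gcd l j = 1%Z -> IZR j * Rabs (IZR j * xi - IZR l) <= 1 -> 0 <= rho ->
  count (fun h => near_int rho (xi * INR h + s)) (seq h0 (Z.to_nat j)) <= 2 * rho * IZR j + 3.
Proof.
  intros Hj Hg Ha Hr. unfold count.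
  set (L := filter _ _).
  set (z := fun h : nat => Zfloor (xi * INR h + s + / 2)).
  set (phi := fun h : nat => (l * Z.of_nat h - j * z h)%Z).
  rewrite <- (length_map phi L).
  assert (Hj' := IZR_le _ _ Hj).
  replace (2 * rho * IZR j + 3) with (2 * (rho * IZR j + 1) + 1) by ring.
  (* The centre is what is left of l h - j z after removing j (xi h + s - z), of size at most rho j,
     and (j xi - l) (h - h0), of size at most 1 because |h - h0| <= j. *)
  apply Z_interval_length with (- IZR j * s + (IZR l - IZR j * xi) * INR h0).
  - nra.
  - apply NoDup_map_in; [apply NoDup_filter, seq_NoDup|].
    intros x y Hx Hy E.
    apply filter_In, proj1, in_seq in Hx. apply filter_In, proj1, in_seq in Hy.
    unfold phi in E.
    assert (D : (j | l * (Z.of_nat x - Z.of_nat y))%Z) by (exists (z x - z y)%Z; lia).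
    apply Z.gauss in D; [|rewrite Z.gcd_comm; assumption].
    destruct D as [k Hk]. assert (k = 0)%Z by nia. subst; lia.
  - intros w Hw. apply in_map_iff in Hw as [h [<- Hh]].
    apply filter_In in Hh as [Hh Hn]. apply in_seq in Hh.
    unfold near_int in Hn. destruct (Rle_dec _ _) as [D|]; [clear Hn|discriminate].
    unfold dist_int in D. fold (z h) in D.
    unfold phi. rewrite minus_IZR, !mult_IZR, <- INR_IZR_INZ.
    replace (_ - _) with (IZR j * (xi * INR h + s - IZR (z h))
        - (IZR j * xi - IZR l) * (INR h - INR h0)) by ring.
    eapply Rle_trans; [apply Rabs_triang|]. rewrite Rabs_Ropp, !Rabs_mult, (Rabs_pos_eq (IZR j)) by lra.
    assert (Rabs (INR h - INR h0) <= IZR j).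
    { rewrite !INR_IZR_INZ, <- minus_IZR, <- abs_IZR. apply IZR_le. lia. }
    assert (0 <= Rabs (IZR j * xi - IZR l)) by apply Rabs_pos.
    assert (0 <= Rabs (INR h - INR h0)) by apply Rabs_pos.
    apply Rplus_le_compat; nra.
Qed.

Lemma count_seq_mono (P : nat -> bool) (h0 m n : nat) : (m <= n)%nat ->
  count P (seq h0 m) <= count P (seq h0 n).
Proof.
  intros H. replace n with (m + (n - m))%nat by lia.
  rewrite seq_app, count_app. assert (G := count_ge0 P (seq (h0 + m) (n - m))). lra.
Qed.

Lemma count_blocks (P : nat -> bool) (j : nat) (c : R) (h0 n : nat) : (1 <= j)%nat ->
  (forall h, count P (seq h j) <= c) -> count P (seq h0 n) <= (INR n / INR j + 1) * c.
Proof.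
  intros Hj H.
  assert (K : forall k h, count P (seq h (k * j)) <= INR k * c).
  { induction k as [|k IH]; intros h; [unfold count; simpl; lra|].
    simpl Nat.mul. rewrite seq_app, count_app, S_INR.
    specialize (IH (h + j)%nat). specialize (H h). lra. }
  assert (Hc : 0 <= c) by (exact (Rle_trans _ _ _ (count_ge0 P _) (H 0%nat))).
  assert (Hj' : 0 < INR j) by (apply lt_0_INR; lia).
  assert (E := Nat.div_mod n j ltac:(lia)).
  assert (M := Nat.mod_upper_bound n j ltac:(lia)).
  (* Round n up to a whole number of blocks; the last one accounts for the [+ 1]. *)
  eapply Rle_trans; [apply (count_seq_mono P h0 n (S (n / j) * j)); lia|].
  eapply Rle_trans; [apply K|]. apply Rmult_le_compat_r; [assumption|].
  rewrite S_INR. apply Rplus_le_compat_r.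
  apply Rmult_le_reg_r with (INR j); [assumption|].
  replace (INR n / INR j * INR j) with (INR n) by (field; lra).
  rewrite <- mult_INR. apply le_INR; lia.
Qed.

Lemma count_near (xi s rho : R) (j l : Z) (h0 n : nat) :
  (1 <= j)%Z -> Z.gcd l j = 1%Z -> IZR j * Rabs (IZR j * xi - IZR l) <= 1 -> 0 <= rho ->
  count (fun h => near_int rho (xi * INR h + s)) (seq h0 n)
  <= (INR n / IZR j + 1) * (2 * rho * IZR j + 3).
Proof.
  intros Hj Hg Ha Hr.
  replace (INR n / IZR j) with (INR n / INR (Z.to_nat j)).
  2:{ rewrite (INR_IZR_INZ (Z.to_nat j)), Z2Nat.id by lia; reflexivity. }
  apply count_blocks; [lia|]. intros h; eapply count_near_block; eassumption.
Qed.

(** * Reduced bases and Dirichlet approximation *)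

Lemma exists_list_min {T} (f : T -> R) (l : list T) : l <> nil ->
  exists x, In x l /\ forall y, In y l -> f x <= f y.
Proof.
  induction l as [|a l IH]; [congruence|intros _].
  destruct l as [|b l].
  - exists a; split; [left; reflexivity|]. intros y [->|[]]; lra.
  - destruct IH as [x [Hx H]]; [congruence|].
    destruct (Rle_dec (f a) (f x)).
    + exists a; split; [left; reflexivity|].
      intros y [->|Hy]; [lra|]. specialize (H y Hy); lra.
    + exists x; split; [right; assumption|].
      intros y [->|Hy]; [lra|auto].
Qed.

(** Squared Euclidean length of (h / X, h xi - p), a vector of a planar lattice of covolume 1 /
    X. *)
Definition lattice_form (xi X : R) (h p : Z) : R :=
  (IZR h / X) ^ 2 + (IZR h * xi - IZR p) ^ 2.

Lemma lattice_form_pos xi X h p : 0 < X -> (h, p) <> (0, 0)%Z -> 0 < lattice_form xi X h p.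
Proof.
  intros HX N. unfold lattice_form.
  destruct (Z.eq_dec h 0) as [->|Nh].
  - assert (p <> 0)%Z by congruence.
    assert (0 < IZR p ^ 2) by (apply pow2_gt_0, not_0_IZR; assumption). nra.
  - assert (0 < (IZR h / X) ^ 2).
    { apply pow2_gt_0. apply Rmult_integral_contrapositive; split.
      - apply not_0_IZR; assumption.
      - apply Rinv_neq_0_compat; lra. }
    generalize (pow2_ge_0 (IZR h * xi - IZR p)); lra.
Qed.

(** The vector (0, 1) has length 1, so any shorter one has |h| <= X and hence |p| <= X (|xi| + 1) +
    1. Only a finite box has to be searched. *)
Lemma lattice_form_min xi X : 1 <= X ->
  exists h p : Z, (h, p) <> (0, 0)%Z /\
  forall h' p' : Z, (h', p') <> (0, 0)%Z -> lattice_form xi X h p <= lattice_form xi X h' p'.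
Proof.
  intros HX.
  set (B := up (X * (Rabs xi + 1) + 1)).
  destruct (archimed (X * (Rabs xi + 1) + 1)) as [HB _]. fold B in HB.
  assert (Hxi := Rabs_pos xi).
  assert (HB1 : 1 < IZR B) by nra. apply lt_IZR in HB1.
  set (rg := map (fun k => (Z.of_nat k - B)%Z) (seq 0 (Z.to_nat (2 * B + 1)))).
  assert (Hrg : forall z, (Z.abs z <= B)%Z -> In z rg).
  { intros z Hz. apply in_map_iff. exists (Z.to_nat (z + B)). split; [lia|apply in_seq; lia]. }
  set (nz := fun v : Z * Z => negb (andb (fst v =? 0)%Z (snd v =? 0)%Z)).
  assert (Hnz : forall h p, nz (h, p) = true <-> (h, p) <> (0, 0)%Z).
  { intros h p. unfold nz; simpl. destruct (Z.eqb_spec h 0), (Z.eqb_spec p 0); simpl;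
    split; congruence. }
  set (L := filter nz (list_prod rg rg)).
  assert (H01 : In (0, 1)%Z L).
  { apply filter_In; split; [|reflexivity]. apply in_prod; apply Hrg; lia. }
  destruct (exists_list_min (fun v => lattice_form xi X (fst v) (snd v)) L) as [[h p] [I M]].
  { intros E; rewrite E in H01; exact H01. }
  apply filter_In in I as [_ I]. apply Hnz in I.
  exists h, p. split; [assumption|]. intros h' p' N. simpl in M.
  assert (M1 := M _ H01). unfold lattice_form at 2 in M1; simpl in M1.
  replace (_ + _) with 1 in M1 by (field; lra).
  destruct (Rle_lt_dec (Rabs (IZR h')) X) as [L1|L1].
  - destruct (Rle_lt_dec (Rabs (IZR p')) (IZR B)) as [L2|L2].
    + apply (M (h', p')). apply filter_In; split; [|apply Hnz; assumption].
      apply in_prod; apply Hrg; apply le_IZR; rewrite abs_IZR; [nra|assumption].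
    + assert (1 <= Rabs (IZR h' * xi - IZR p')).
      { assert (T := Rabs_triang_inv (IZR p') (IZR h' * xi)).
        rewrite Rabs_mult in T. rewrite Rabs_minus_sym in T. nra. }
      assert (1 <= (IZR h' * xi - IZR p') ^ 2) by (rewrite <- pow2_abs; nra).
      unfold lattice_form at 2. generalize (pow2_ge_0 (IZR h' / X)); lra.
  - assert (1 <= Rabs (IZR h' / X)).
    { unfold Rdiv. rewrite Rabs_mult, (Rabs_pos_eq (/ X)) by (left; apply Rinv_0_lt_compat; lra).
      apply Rmult_le_reg_r with X; [lra|]. rewrite Rmult_assoc, Rinv_l; lra. }
    assert (1 <= (IZR h' / X) ^ 2) by (rewrite <- pow2_abs; nra).
    unfold lattice_form at 2. generalize (pow2_ge_0 (IZR h' * xi - IZR p')); lra.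
Qed.

(* Gauss reduction of the form [(h/X)^2 + (h xi - p)^2], of determinant [X^-2]. *)
Lemma reduced_basis xi X : 1 <= X ->
  exists (h1 p1 h2 p2 : Z) (r1 r2 : R),
    (0 <= h1)%Z /\ (0 <= h2)%Z /\ ((h1 * p2 - h2 * p1) ^ 2 = 1)%Z /\
    0 < r1 /\ r1 <= r2 /\ r1 * r2 * X <= 2 /\
    r1 ^ 2 = lattice_form xi X h1 p1 /\ r2 ^ 2 = lattice_form xi X h2 p2.
Proof.
  intros HX. destruct (lattice_form_min xi X HX) as [h1 [p1 [N1 M]]].
  assert (P1 := lattice_form_pos xi X h1 p1 ltac:(lra) N1).
  set (q1 := lattice_form xi X h1 p1) in *.
  (* A shortest vector is primitive: a common factor g >= 2 would multiply the form by g^2 >= 4. *)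
  assert (Hg : Z.gcd h1 p1 = 1%Z).
  { destruct (Z.gcd_divide_l h1 p1) as [a Ha], (Z.gcd_divide_r h1 p1) as [b Hb].
    assert (Hg0 := Z.gcd_nonneg h1 p1). set (g := Z.gcd h1 p1) in *.
    assert (g <> 0)%Z by (intros E; apply N1; rewrite E in *; f_equal; lia).
    assert (Hab : (a, b) <> (0, 0)%Z).
    { intros E; injection E; intros; subst a b; apply N1; f_equal; lia. }
    specialize (M a b Hab).
    assert (E : q1 = IZR g ^ 2 * lattice_form xi X a b).
    { unfold q1, lattice_form. rewrite Ha, Hb, !mult_IZR. field; lra. }
    assert (P := lattice_form_pos xi X a b ltac:(lra) Hab).
    destruct (Z_le_gt_dec 2 g) as [G|G]; [|lia].
    apply IZR_le in G. assert (4 <= IZR g ^ 2) by nra. nra. }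
  (* Bezout completes (h1, p1) by (-v, u) to a basis of determinant 1. Subtracting the nearest
     multiple [k] of the first vector keeps the determinant and makes the inner product [q12] at
     most q1 / 2. *)
  destruct (Z.gcd_bezout h1 p1 1 Hg) as [u [v Huv]].
  set (q12 := fun h2 p2 : Z => IZR h1 / X * (IZR h2 / X)
     + (IZR h1 * xi - IZR p1) * (IZR h2 * xi - IZR p2)).
  set (k := Zfloor (q12 (- v)%Z u / q1 + / 2)).
  set (h2 := (- v - k * h1)%Z). set (p2 := (u - k * p1)%Z).
  assert (D : (h1 * p2 - h2 * p1 = 1)%Z) by (unfold h2, p2; nia).
  assert (Hq : Rabs (q12 h2 p2) <= q1 / 2).
  { assert (Hk := Zfloor_bound (q12 (- v)%Z u / q1 + / 2)). fold k in Hk.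
    replace (q12 h2 p2) with (q1 * (q12 (- v)%Z u / q1 - IZR k)).
    2:{ replace (q12 (- v)%Z u / q1 - IZR k) with ((q12 (- v)%Z u - IZR k * q1) / q1) by (field; lra).
        replace (q1 * _) with (q12 (- v)%Z u - IZR k * q1) by (field; lra).
        unfold q12, h2, p2, q1, lattice_form. rewrite !minus_IZR, !mult_IZR. field; lra. }
    rewrite Rabs_mult, (Rabs_pos_eq q1) by lra.
    apply Rmult_le_compat_l; [lra|]. apply Rabs_le; lra. }
  assert (N2 : (h2, p2) <> (0, 0)%Z) by (intros E; injection E; intros; nia).
  set (q2 := lattice_form xi X h2 p2).
  assert (M2 : q1 <= q2) by (apply M; assumption).
  (* Lagrange's identity with determinant 1. Together with q12^2 <= q1 q2 / 4 it gives q1 q2 <= 4 /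
     (3 X^2). *)
  assert (I : q1 * q2 = q12 h2 p2 ^ 2 + / X ^ 2).
  { transitivity (q12 h2 p2 ^ 2 + (IZR (h1 * p2 - h2 * p1)) ^ 2 / X ^ 2).
    - unfold q1, q2, q12, lattice_form. rewrite minus_IZR, !mult_IZR. field; lra.
    - rewrite D. field; lra. }
  assert (Hq2 : q12 h2 p2 ^ 2 <= q1 * q2 / 4).
  { rewrite <- pow2_abs. assert (0 <= Rabs (q12 h2 p2)) by apply Rabs_pos. nra. }
  assert (HX2 : 0 < / X ^ 2) by (apply Rinv_0_lt_compat, pow_lt; lra).
  assert (Hr : sqrt q1 * sqrt q2 * X <= 2).
  { rewrite <- sqrt_mult by lra.
    enough ((sqrt (q1 * q2) * X) ^ 2 <= 2 ^ 2).
    { assert (0 <= sqrt (q1 * q2) * X) by (apply Rmult_le_pos; [apply sqrt_pos|lra]). nra. }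
    rewrite Rpow_mult_distr, pow2_sqrt by nra.
    replace (2 ^ 2) with (4 * / X ^ 2 * X ^ 2) by (field; lra).
    apply Rmult_le_compat_r; [apply pow2_ge_0|nra]. }
  (* Shifts must be nonnegative, so a vector with h < 0 is replaced by its opposite. This may flip
     the sign of the determinant, whence the square in the statement. *)
  assert (S : forall h p : Z, exists h' p' : Z, (0 <= h')%Z /\
     ((h' = h /\ p' = p) \/ (h' = - h /\ p' = - p)%Z) /\ lattice_form xi X h' p' = lattice_form xi X h p).
  { intros h p. destruct (Z_le_gt_dec 0 h).
    - exists h, p. auto.
    - exists (- h)%Z, (- p)%Z. split; [lia|]. split; [auto|].
      unfold lattice_form. rewrite !opp_IZR. field; lra. }
  destruct (S h1 p1) as [h1' [p1' [A1 [B1 C1]]]], (S h2 p2) as [h2' [p2' [A2 [B2 C2]]]].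
  exists h1', p1', h2', p2', (sqrt q1), (sqrt q2).
  rewrite !pow2_sqrt by lra.
  repeat split; try assumption; try (symmetry; assumption).
  - replace 1%Z with ((h1 * p2 - h2 * p1) ^ 2)%Z by (rewrite D; reflexivity).
    destruct B1 as [[-> ->]|[-> ->]], B2 as [[-> ->]|[-> ->]]; ring.
  - apply sqrt_lt_R0; assumption.
  - apply sqrt_le_1_alt; assumption.
Qed.

(** The product bound is the arithmetic-geometric mean inequality. Its factor 1/2 matters: with r1^2
    X <= 2 it yields the bound 1 that [count_near_block] requires. *)
Lemma lattice_form_bounds xi X h p r : 0 < X -> 0 < r -> (0 <= h)%Z -> r ^ 2 = lattice_form xi X h p ->
  0 <= IZR h <= r * X /\ Rabs (IZR h * xi - IZR p) <= r /\
  IZR h * Rabs (IZR h * xi - IZR p) <= r ^ 2 * X / 2.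
Proof.
  intros HX Hr Hh E. unfold lattice_form in E.
  set (y := IZR h / X) in *. set (t := IZR h * xi - IZR p) in *.
  assert (Hy : 0 <= y) by (apply Rdiv_le_0_compat; [apply IZR_le|]; assumption).
  replace (IZR h) with (y * X) by (unfold y; field; lra).
  rewrite <- (pow2_abs t) in E.
  assert (0 <= Rabs t) by apply Rabs_pos. set (s := Rabs t) in *. clearbody y s.
  assert (y <= r) by nra. assert (s <= r) by nra.
  assert (y * s <= r ^ 2 / 2) by (generalize (pow2_ge_0 (y - s)); nra).
  assert (y * X <= r * X) by (apply Rmult_le_compat_r; lra).
  assert (X * (y * s) <= X * (r ^ 2 / 2)) by (apply Rmult_le_compat_l; lra).
  assert (0 <= y * X) by (apply Rmult_le_pos; lra).
  repeat split; lra.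
Qed.

(** The shortest vector at scale Q^2 has r1^2 Q^2 <= 2. It has h1 <> 0, as otherwise r1 >= 1, and it
    is primitive because it belongs to a basis. The last bound is the hypothesis of [count_near]. *)
Lemma dirichlet_approximation xi Q : 2 <= Q ->
  exists j l : Z, (1 <= j)%Z /\ Z.gcd l j = 1%Z /\ IZR j <= 2 * Q /\
    Rabs (IZR j * xi - IZR l) <= 2 / Q /\ IZR j * Rabs (IZR j * xi - IZR l) <= 1.
Proof.
  intros HQ.
  destruct (reduced_basis xi (Q ^ 2) ltac:(nra)) as (h1 & p1 & h2 & p2 & r1 & r2 & A1 & A2 & D & R1 & R2 & R3 & E1 & E2).
  destruct (lattice_form_bounds xi (Q ^ 2) h1 p1 r1 ltac:(nra) R1 A1 E1) as (B1 & B2 & B3).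
  assert (H : (r1 * Q) ^ 2 <= 2) by nra.
  assert (Hr : r1 * Q <= 2) by nra.
  assert (Nh : (h1 <> 0)%Z).
  { intros ->. assert (N : p1 <> 0%Z) by (intros ->; rewrite Z.mul_0_r in D; discriminate).
    assert (1 <= IZR p1 ^ 2) by (rewrite pow_IZR; apply IZR_le; simpl Z.of_nat; nia).
    unfold lattice_form in E1.
    replace ((0 / Q ^ 2) ^ 2 + (0 * xi - IZR p1) ^ 2) with (IZR p1 ^ 2) in E1 by (field; nra).
    nra. }
  exists h1, p1. repeat split.
  - lia.
  - apply Z.bezout_1_gcd. destruct (Z.eq_dec (h1 * p2 - h2 * p1) 1) as [d|d].
    + exists (- h2)%Z, p2. lia.
    + exists h2, (- p2)%Z. nia.
  - nra.
  - apply Rmult_le_reg_r with Q; [lra|]. replace (2 / Q * Q) with 2 by (field; lra). nra.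
  - nra.
Qed.

(** * Bilinear sums and shifts *)

(** Cauchy-Schwarz in b removes [w]. Expanding the square leaves pairs (a, a') with linear phases in
    b, and the weights [u] disappear on taking absolute values, so a bound uniform in a'
    suffices. *)
Lemma bilinear_sum_sq (u w : nat -> C) (xi M : R) (A B : nat) :
  (forall a, Cmod (u a) <= 1) -> (forall b, Cmod (w b) <= 1) ->
  (forall a', In a' (seq 0 A) ->
     Rsum (seq 0 A) (fun a => Cmod (Csum (seq 0 B) (fun b => e (xi * (INR a - INR a') * INR b)))) <= M) ->
  Cmod (Csum (seq 0 A) (fun a => Csum (seq 0 B) (fun b =>
    (u a * w b * e (xi * (INR a * INR b)))%C))) ^ 2 <= INR A * INR B * M.
Proof.
  intros Hu Hw HM.
  set (z := fun b => Csum (seq 0 A) (fun a => (u a * e (xi * (INR a * INR b)))%C)).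
  rewrite Csum_exchange.
  rewrite (Csum_ext _ _ (fun b => (w b * z b)%C)).
  2:{ intros b _. unfold z. rewrite <- Csum_scal. apply Csum_ext; intros; ring. }
  assert (S1 : Cmod (Csum (seq 0 B) (fun b => (w b * z b)%C)) <= Rsum (seq 0 B) (fun b => Cmod (z b))).
  { eapply Rle_trans; [apply Cmod_Csum_le|]. apply Rsum_le. intros b _.
    rewrite Cmod_mult. specialize (Hw b). assert (0 <= Cmod (z b)) by apply Cmod_ge_0. nra. }
  assert (S2 := Cauchy_Schwarz_Rsum (seq 0 B) (fun b => Cmod (z b))). rewrite length_seq in S2.
  assert (S3 : Rsum (seq 0 B) (fun b => Cmod (z b) ^ 2) <= INR A * M).
  { eapply Rle_trans; [apply Rle_abs|]. rewrite <- Cmod_R, <- Csum_RtoC.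
    rewrite (Csum_ext _ _ (fun b => Csum (seq 0 A) (fun a' => Csum (seq 0 A) (fun a =>
      (u a * Cconj (u a') * e (xi * (INR a - INR a') * INR b))%C)))).
    2:{ intros b _. rewrite Cmod2_conj. unfold z at 2. rewrite Csum_conj, <- Csum_scal.
        apply Csum_ext; intros a' _. unfold z. rewrite Cmult_comm, <- Csum_scal.
        apply Csum_ext; intros a _. rewrite Cmult_conj, e_conj.
        replace (xi * (INR a - INR a') * INR b)
          with (xi * (INR a * INR b) + - (xi * (INR a' * INR b))) by ring.
        rewrite e_plus; ring. }
    rewrite Csum_exchange. replace (INR A) with (INR (length (seq 0 A))) by (rewrite length_seq; reflexivity).
    apply Cmod_Csum_le_const. intros a' Ha'. eapply Rle_trans; [|apply (HM a' Ha')].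
    rewrite Csum_exchange. eapply Rle_trans; [apply Cmod_Csum_le|]. apply Rsum_le. intros a _.
    rewrite Csum_scal, !Cmod_mult, Cmod_conj.
    assert (H1 := Hu a). assert (H2 := Hu a'). assert (P1 := Cmod_ge_0 (u a)). assert (P2 := Cmod_ge_0 (u a')).
    rewrite <- (Rmult_1_l (Cmod (Csum _ _))) at 2.
    apply Rmult_le_compat_r; [apply Cmod_ge_0|nra]. }
  assert (P := Cmod_ge_0 (Csum (seq 0 B) (fun b => (w b * z b)%C))).
  assert (0 <= INR B) by apply pos_INR.
  nra.
Qed.

(** For fixed a', the sum over b is a geometric sum, at most 1 / rho unless xi (a - a') is within
    rho of an integer. Those exceptional a are counted by [count_near] and cost B each. *)
Lemma bilinear_sum_le (u w : nat -> C) (xi rho : R) (j l : Z) (A B : nat) :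
  (forall a, Cmod (u a) <= 1) -> (forall b, Cmod (w b) <= 1) ->
  (1 <= j)%Z -> Z.gcd l j = 1%Z -> IZR j * Rabs (IZR j * xi - IZR l) <= 1 -> 0 < rho ->
  Cmod (Csum (seq 0 A) (fun a => Csum (seq 0 B) (fun b =>
    (u a * w b * e (xi * (INR a * INR b)))%C))) ^ 2
  <= INR A * INR B * (INR A * (1 / rho) + (INR A / IZR j + 1) * (2 * rho * IZR j + 3) * INR B).
Proof.
  intros Hu Hw Hj Hg Ha Hr. apply bilinear_sum_sq; [assumption|assumption|].
  intros a' _.
  eapply Rle_trans.
  - apply (Rsum_le_count (fun a => near_int rho (xi * INR a + - (xi * INR a'))) _ _ (1 / rho) (INR B)).
    + apply Rdiv_le_0_compat; lra.
    + intros a _ H. unfold near_int in H. destruct (Rle_dec _ _) as [|N]; [discriminate|].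
      apply geometric_sum_le; [assumption|].
      replace (xi * (INR a - INR a')) with (xi * INR a + - (xi * INR a')) by ring. lra.
    + intros a _. replace (INR B) with (INR (length (seq 0 B)) * 1) by (rewrite length_seq; ring).
      apply Cmod_Csum_le_const. intros; rewrite Cmod_e; lra.
  - rewrite length_seq. apply Rplus_le_compat_l, Rmult_le_compat_r; [apply pos_INR|].
    apply count_near with (l := l); try assumption; lra.
Qed.

(** Each unit step exchanges one term at either end of the range. *)
Lemma Csum_translate (G : Z -> C) (N k : nat) : (forall n, Cmod (G n) <= 1) ->
  Cmod (Csum (seq 1 N) (fun n => G (Z.of_nat n))
        - Csum (seq 1 N) (fun n => G (Z.of_nat n + Z.of_nat k)%Z)) <= 2 * INR k.
Proof.
  intros H. induction k as [|k IH].
  - rewrite (Csum_ext _ (fun n => G (Z.of_nat n + Z.of_nat 0)%Z) (fun n => G (Z.of_nat n))).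
    2:{ intros n _; f_equal; lia. }
    replace (_ - _)%C with (RtoC 0) by ring. rewrite Cmod_0; simpl; lra.
  - assert (E : (Csum (seq 1 N) (fun n => G (Z.of_nat n + Z.of_nat (S k))%Z)
       = Csum (seq 1 N) (fun n => G (Z.of_nat n + Z.of_nat k)%Z)
         + G (Z.of_nat (S N) + Z.of_nat k)%Z - G (1 + Z.of_nat k)%Z)%C).
    { rewrite (Csum_ext _ _ (fun n => G (Z.of_nat (S n) + Z.of_nat k)%Z)).
      2:{ intros n _; f_equal; lia. }
      rewrite <- (Csum_map _ S (fun n => G (Z.of_nat n + Z.of_nat k)%Z)), seq_shift.
      assert (T : Csum (seq 1 (S N)) (fun n => G (Z.of_nat n + Z.of_nat k)%Z)
        = (Csum (seq 1 N) (fun n => G (Z.of_nat n + Z.of_nat k)%Z) + G (Z.of_nat (S N) + Z.of_nat k)%Z)%C).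
      { rewrite Csum_seq_S; reflexivity. }
      rewrite <- T. change (seq 1 (S N)) with (1%nat :: seq 2 N). rewrite Csum_cons.
      change (Z.of_nat 1) with 1%Z. ring. }
    rewrite E, S_INR.
    replace (_ - _)%C with ((Csum (seq 1 N) (fun n => G (Z.of_nat n))
        - Csum (seq 1 N) (fun n => G (Z.of_nat n + Z.of_nat k)%Z))
        + (- G (Z.of_nat (S N) + Z.of_nat k)%Z + G (1 + Z.of_nat k)%Z))%C by ring.
    eapply Rle_trans; [apply Cmod_triangle|].
    assert (T := Cmod_triangle (- G (Z.of_nat (S N) + Z.of_nat k)%Z) (G (1 + Z.of_nat k)%Z)).
    rewrite Cmod_opp in T.
    assert (H1 := H (Z.of_nat (S N) + Z.of_nat k)%Z). assert (H2 := H (1 + Z.of_nat k)%Z). lra.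
Qed.

(** No integer lies within rho of x, so a perturbation of size at most rho cannot carry x across
    one. *)
Lemma Zfloor_translate (x y rho : R) (P : Z) : rho < dist_int x -> Rabs (y - IZR P) <= rho ->
  Zfloor (x + y) = (Zfloor x + P)%Z.
Proof.
  intros H Hy. apply Rabs_le_between' in Hy.
  assert (B := Zfloor_bound x).
  assert (D1 := dist_int_le x (Zfloor x)). rewrite Rabs_pos_eq in D1 by lra.
  assert (D2 := dist_int_le x (Zfloor x + 1)). rewrite plus_IZR, Rabs_left1 in D2 by lra.
  apply Zfloor_eq. rewrite plus_IZR. lra.
Qed.

(** The n at which a shift with error at most rho may change the floor by something other than the
    expected integer. *)
Definition bad_count (beta rho : R) (N : nat) : R :=
  count (fun n => near_int rho (beta * INR n)) (seq 1 N).

Lemma shifted_sum (theta beta rho : R) (N s : nat) (P : Z) :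
  Rabs (beta * INR s - IZR P) <= rho ->
  Cmod (Csum (seq 1 N) (fun n => e (- theta * INR n * IZR (Zfloor (beta * INR n))))
        - Csum (seq 1 N) (fun n => e (- theta * (INR n + INR s) * IZR (Zfloor (beta * INR n) + P))))
  <= 2 * INR s + 2 * bad_count beta rho N.
Proof.
  intros H.
  set (G := fun n : Z => e (- theta * IZR n * IZR (Zfloor (beta * IZR n)))).
  assert (T := Csum_translate G N s ltac:(intros; unfold G; rewrite Cmod_e; lra)).
  rewrite (Csum_ext _ _ (fun n => G (Z.of_nat n))).
  2:{ intros n _. unfold G. rewrite !INR_IZR_INZ. reflexivity. }
  match goal with |- Cmod (?a - ?c) <= _ =>
    set (U := c); replace (a - U)%C with ((a - Csum (seq 1 N) (fun n => G (Z.of_nat n + Z.of_nat s)%Z))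
      + (Csum (seq 1 N) (fun n => G (Z.of_nat n + Z.of_nat s)%Z) - U))%C by ring end.
  eapply Rle_trans; [apply Cmod_triangle|]. apply Rplus_le_compat; [exact T|].
  unfold U. rewrite <- Csum_minus. eapply Rle_trans; [apply Cmod_Csum_le|].
  eapply Rle_trans.
  - apply (Rsum_le_count (fun n => near_int rho (beta * INR n)) _ _ 0 2); [lra| |].
    + intros n _ Hn. unfold near_int in Hn. destruct (Rle_dec _ _) as [|D]; [discriminate|].
      unfold G. rewrite !plus_IZR, <- !INR_IZR_INZ.
      rewrite (Rmult_plus_distr_l beta), (Zfloor_translate _ _ rho P), plus_IZR; [|lra|assumption].
      match goal with |- Cmod (?a - ?a) <= _ => replace (a - a)%C with (RtoC 0) by ring end.
      rewrite Cmod_0; lra.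
    + intros n _. eapply Rle_trans; [apply Cmod_triangle|]. unfold G. rewrite Cmod_opp, !Cmod_e. lra.
  - unfold bad_count. lra.
Qed.

Lemma bad_count_le (beta rho : R) (j l : Z) (N : nat) :
  (1 <= j)%Z -> Z.gcd l j = 1%Z -> IZR j * Rabs (IZR j * beta - IZR l) <= 1 -> 0 <= rho ->
  bad_count beta rho N <= (INR N / IZR j + 1) * (2 * rho * IZR j + 3).
Proof.
  intros Hj Hg Ha Hr. eapply Rle_trans; [|apply (count_near beta 0 rho j l 1 N); assumption].
  unfold bad_count, count. right. do 2 f_equal. apply filter_ext. intros n. now rewrite Rplus_0_r.
Qed.

(** The summand after the shift by a (h, p) + b (h', p'). The two vectors may coincide, as they do
    for the diagonal pairs (v1, v1) and (v2, v2). *)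
Definition box_term (theta beta : R) (h p h' p' : Z) (n a b : nat) : C :=
  e (- theta * (INR n + (INR a * IZR h + INR b * IZR h'))
     * (IZR (Zfloor (beta * INR n)) + (INR a * IZR p + INR b * IZR p'))).

Lemma box_shift (theta beta rho : R) (h p h' p' : Z) (N A B a b : nat) :
  (0 <= h)%Z -> (0 <= h')%Z ->
  INR A * Rabs (IZR h * beta - IZR p) + INR B * Rabs (IZR h' * beta - IZR p') <= rho ->
  (a <= A)%nat -> (b <= B)%nat ->
  Cmod (Csum (seq 1 N) (fun n => e (- theta * INR n * IZR (Zfloor (beta * INR n))))
        - Csum (seq 1 N) (fun n => box_term theta beta h p h' p' n a b))
  <= 2 * (INR A * IZR h + INR B * IZR h') + 2 * bad_count beta rho N.
Proof.
  intros Hh Hh' Hr Ha Hb.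
  set (s := Z.to_nat (Z.of_nat a * h + Z.of_nat b * h')).
  set (P := (Z.of_nat a * p + Z.of_nat b * p')%Z).
  assert (Es : INR s = INR a * IZR h + INR b * IZR h').
  { unfold s. rewrite !INR_IZR_INZ, Z2Nat.id by nia. now rewrite plus_IZR, !mult_IZR. }
  assert (EP : IZR P = INR a * IZR p + INR b * IZR p').
  { unfold P. now rewrite !INR_IZR_INZ, plus_IZR, !mult_IZR. }
  apply le_INR in Ha. apply le_INR in Hb. apply IZR_le in Hh. apply IZR_le in Hh'.
  assert (Hs : Rabs (beta * INR s - IZR P) <= rho).
  { rewrite Es, EP.
    replace (_ - _) with (INR a * (IZR h * beta - IZR p) + INR b * (IZR h' * beta - IZR p')) by ring.
    eapply Rle_trans; [apply Rabs_triang|]. eapply Rle_trans; [|exact Hr].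
    rewrite !Rabs_mult, !(Rabs_pos_eq (INR _)) by apply pos_INR.
    apply Rplus_le_compat; apply Rmult_le_compat_r; auto using Rabs_pos. }
  assert (T := shifted_sum theta beta rho N s P Hs).
  rewrite (Csum_ext _ (fun n => box_term theta beta h p h' p' n a b)
     (fun n => e (- theta * (INR n + INR s) * IZR (Zfloor (beta * INR n) + P)))).
  2:{ intros n _. unfold box_term. rewrite plus_IZR, EP, Es. reflexivity. }
  eapply Rle_trans; [exact T|]. rewrite Es.
  assert (INR a * IZR h <= INR A * IZR h) by (apply Rmult_le_compat_r; lra).
  assert (INR b * IZR h' <= INR B * IZR h') by (apply Rmult_le_compat_r; lra).
  lra.
Qed.

(** Replace the sum by its average over all shifts of the box, exchange the order, and bound the box
    sum for each n. The factor A B stays on both sides so that empty boxes need no separate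
    treatment. *)
Lemma box_average_le (theta beta rho W : R) (h p h' p' : Z) (N A B : nat) :
  (0 <= h)%Z -> (0 <= h')%Z ->
  INR A * Rabs (IZR h * beta - IZR p) + INR B * Rabs (IZR h' * beta - IZR p') <= rho ->
  (forall n, Cmod (Csum (seq 0 A) (fun a => Csum (seq 0 B) (fun b =>
     box_term theta beta h p h' p' n a b))) <= INR A * INR B * W) ->
  INR A * INR B * Cmod (Csum (seq 1 N) (fun n => e (- theta * INR n * IZR (Zfloor (beta * INR n)))))
  <= INR A * INR B * (2 * (INR A * IZR h + INR B * IZR h') + 2 * bad_count beta rho N + INR N * W).
Proof.
  intros Hh Hh' Hr HW.
  set (S := Csum (seq 1 N) _). set (D := 2 * _ + 2 * _).
  set (T := Csum (seq 0 A) (fun a => Csum (seq 0 B) (fun b =>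
     Csum (seq 1 N) (fun n => box_term theta beta h p h' p' n a b)))).
  assert (E1 : Cmod (INR A * INR B * S - T) <= INR A * (INR B * D)).
  { replace (INR A * INR B * S)%C with (Csum (seq 0 A) (fun a => Csum (seq 0 B) (fun b => S))).
    2:{ rewrite !Csum_const, !length_seq. ring. }
    unfold T. rewrite <- Csum_minus.
    replace (INR A) with (INR (length (seq 0 A))) by now rewrite length_seq.
    apply Cmod_Csum_le_const. intros a Ha. apply in_seq in Ha.
    rewrite <- Csum_minus.
    replace (INR B) with (INR (length (seq 0 B))) by now rewrite length_seq.
    apply Cmod_Csum_le_const. intros b Hb. apply in_seq in Hb.
    unfold S, D. apply box_shift; auto; lia. }
  assert (E2 : Cmod T <= INR N * (INR A * INR B * W)).
  { unfold T. rewrite (Csum_ext _ _ (fun a => Csum (seq 1 N) (fun n => Csum (seq 0 B) (fun b =>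
      box_term theta beta h p h' p' n a b)))) by (intros; apply Csum_exchange).
    rewrite Csum_exchange.
    replace (INR N) with (INR (length (seq 1 N))) by now rewrite length_seq.
    apply Cmod_Csum_le_const. intros n _. apply HW. }
  replace (INR A * INR B * Cmod S) with (Cmod (INR A * INR B * S)).
  2:{ rewrite !Cmod_mult, !Cmod_R, !Rabs_pos_eq by apply pos_INR. reflexivity. }
  replace (INR A * INR B * S)%C with ((INR A * INR B * S - T) + T)%C by ring.
  eapply Rle_trans; [apply Cmod_triangle|]. lra.
Qed.

(* Both shifts enter the box sum bilinearly apart from the phase
   [theta a b (h p' + h' p)], whose coefficient must then be close to a
   rational with small denominator. *)
Lemma box_term_bilinear (theta beta rho : R) (h p h' p' j l : Z) (n A B : nat) :
  (1 <= j)%Z -> Z.gcd l j = 1%Z ->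
  let xi := - theta * (IZR h * IZR p' + IZR h' * IZR p) in
  IZR j * Rabs (IZR j * xi - IZR l) <= 1 -> 0 < rho ->
  Cmod (Csum (seq 0 A) (fun a => Csum (seq 0 B) (fun b =>
    box_term theta beta h p h' p' n a b))) ^ 2
  <= INR A * INR B * (INR A * (1 / rho) + (INR A / IZR j + 1) * (2 * rho * IZR j + 3) * INR B).
Proof.
  intros Hj Hg xi Ha Hr. set (m := IZR (Zfloor (beta * INR n))).
  set (u := fun a : nat => e (- theta * (INR n + INR a * IZR h) * (m + INR a * IZR p))).
  set (w := fun b : nat => e (- theta * (INR n * (INR b * IZR p') + INR b * IZR h' * m
     + INR b * IZR h' * (INR b * IZR p')))).
  rewrite (Csum_ext _ _ (fun a => Csum (seq 0 B) (fun b => (u a * w b * e (xi * (INR a * INR b)))%C))).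
  2:{ intros a _. apply Csum_ext. intros b _. unfold u, w, xi, box_term. rewrite <- !e_plus.
      f_equal. fold m. ring. }
  apply bilinear_sum_le with (l := l); try assumption; intros; unfold u, w; rewrite Cmod_e; lra.
Qed.

(** Dirichlet gives a denominator j <= 2 Q with error 2 / Q. If j exceeded 64 / g^2, the bilinear
    estimate would bound every box sum by A B g / 2; with the losses of at most g N / 2 the mean
    could not exceed g. *)
Lemma large_sum_rational (theta beta rho g : R) (h p h' p' : Z) (N A B : nat) :
  (0 <= h)%Z -> (0 <= h')%Z ->
  INR A * Rabs (IZR h * beta - IZR p) + INR B * Rabs (IZR h' * beta - IZR p') <= rho ->
  0 < g -> g <= / 64 -> 2048 / g ^ 4 <= INR A -> 2048 / g ^ 4 <= INR B ->
  2 * (INR A * IZR h + INR B * IZR h') + 2 * bad_count beta rho N <= g / 2 * INR N ->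
  g * INR N < Cmod (Csum (seq 1 N) (fun n => e (- theta * INR n * IZR (Zfloor (beta * INR n))))) ->
  exists j l : Z, (1 <= j)%Z /\ IZR j <= 64 / g ^ 2 /\
    Rabs (IZR j * (theta * (IZR h * IZR p' + IZR h' * IZR p)) - IZR l) <= 2 / (g ^ 6 * (INR A * INR B)).
Proof.
  intros Hh Hh' Hr Hg Hg' HA HB HD HS.
  set (xi := - theta * (IZR h * IZR p' + IZR h' * IZR p)).
  set (a := INR A) in *. set (b := INR B) in *.
  assert (G4 : 0 < g ^ 4) by (apply pow_lt; lra).
  assert (HA' : 2048 <= a * g ^ 4).
  { apply Rmult_le_compat_r with (r := g ^ 4) in HA; [|lra]. unfold Rdiv in HA.
    rewrite Rmult_assoc, Rinv_l in HA; lra. }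
  assert (HB' : 2048 <= b * g ^ 4).
  { apply Rmult_le_compat_r with (r := g ^ 4) in HB; [|lra]. unfold Rdiv in HB.
    rewrite Rmult_assoc, Rinv_l in HB; lra. }
  assert (g4 : g ^ 4 <= / 4096 * / 4096).
  { replace (g ^ 4) with (g ^ 2 * g ^ 2) by ring. assert (g ^ 2 <= / 4096) by nra.
    assert (0 <= g ^ 2) by apply pow2_ge_0. nra. }
  assert (a0 : 1 <= a) by nra. assert (b0 : 1 <= b) by nra.
  assert (g2 : 0 < g ^ 2) by (apply pow_lt; lra).
  assert (g2' : g ^ 2 <= / 4096) by nra.
  set (Q := g ^ 6 * (a * b)).
  assert (HQ : 2 <= Q).
  { unfold Q. apply Rle_trans with ((a * g ^ 4) * (b * g ^ 4)); [nra|].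
    replace (a * g ^ 4 * (b * g ^ 4)) with (g ^ 6 * (a * b) * g ^ 2) by ring.
    assert (0 < g ^ 6 * (a * b)) by (repeat apply Rmult_lt_0_compat; lra). nra. }
  destruct (dirichlet_approximation xi Q HQ) as (j & l & Hj & Hgcd & HjQ & Hap & Hap1).
  assert (Hj1 := IZR_le _ _ Hj).
  destruct (Rle_lt_dec (IZR j) (64 / g ^ 2)) as [Hs|Hs].
  { exists j, (- l)%Z. repeat split; try assumption.
    rewrite opp_IZR. unfold xi in Hap. rewrite <- Rabs_Ropp.
    replace (- _) with (IZR j * (- theta * (IZR h * IZR p' + IZR h' * IZR p)) - IZR l) by ring.
    exact Hap. }
  exfalso.
  (* Chosen so that the geometric sums contribute A / r = A B g^2 / 32. *)
  set (r := 32 / (g ^ 2 * b)).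
  assert (r0 : 0 < r) by (apply Rdiv_lt_0_compat; nra).
  assert (Hj64 : 64 < IZR j * g ^ 2).
  { apply Rmult_lt_compat_r with (r := g ^ 2) in Hs; [|lra]. unfold Rdiv in Hs.
    rewrite Rmult_assoc, Rinv_l in Hs; lra. }
  assert (HW : forall n, Cmod (Csum (seq 0 A) (fun a => Csum (seq 0 B) (fun b =>
     box_term theta beta h p h' p' n a b))) <= a * b * (g / 2)).
  { intros n. assert (T := box_term_bilinear theta beta r h p h' p' j l n A B Hj Hgcd Hap1 r0).
    fold a b in T. match goal with |- Cmod ?z <= _ => set (M := Cmod z) in * end.
    assert (0 <= M) by apply Cmod_ge_0.
    (* The five terms total at most 11 g^2 / 64. The hypothesis on B handles 64 / (g^2 b), the
       assumption on j handles 3 / j, and j <= 2 Q with g <= 1/64 handles the term growing with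
       j. *)
    assert (T2 : a * (1 / r) + (a / IZR j + 1) * (2 * r * IZR j + 3) * b <= a * b * (g ^ 2 / 4)).
    { replace (a * (1 / r) + (a / IZR j + 1) * (2 * r * IZR j + 3) * b)
        with (a * b * (g ^ 2 / 32 + 64 / (g ^ 2 * b) + 3 / IZR j + 64 * IZR j / (g ^ 2 * (a * b)) + 3 / a)).
      2:{ unfold r. field. repeat split; lra. }
      apply Rmult_le_compat_l; [nra|].
      assert (64 / (g ^ 2 * b) <= g ^ 2 / 32).
      { apply Rmult_le_reg_r with (g ^ 2 * b); [nra|].
        replace (64 / (g ^ 2 * b) * (g ^ 2 * b)) with 64 by (field; lra).
        replace (g ^ 2 / 32 * (g ^ 2 * b)) with (b * g ^ 4 / 32) by field. lra. }
      assert (3 / IZR j <= 3 * g ^ 2 / 64).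
      { apply Rmult_le_reg_r with (IZR j); [lra|].
        replace (3 / IZR j * IZR j) with 3 by (field; lra). lra. }
      assert (64 * IZR j / (g ^ 2 * (a * b)) <= g ^ 2 / 32).
      { apply Rmult_le_reg_r with (g ^ 2 * (a * b)); [nra|].
        replace (64 * IZR j / (g ^ 2 * (a * b)) * (g ^ 2 * (a * b))) with (64 * IZR j) by (field; lra).
        replace (g ^ 2 / 32 * (g ^ 2 * (a * b))) with (g ^ 4 * (a * b) / 32) by field.
        apply Rle_trans with (128 * Q); [lra|]. unfold Q.
        replace (g ^ 6 * (a * b)) with (g ^ 2 * (g ^ 4 * (a * b))) by ring.
        assert (0 <= g ^ 4 * (a * b)) by (apply Rmult_le_pos; nra). nra. }
      assert (3 / a <= g ^ 2 / 32).
      { apply Rmult_le_reg_r with a; [lra|]. replace (3 / a * a) with 3 by (field; lra).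
        assert (a * g ^ 4 <= a * g ^ 2); [|lra]. apply Rmult_le_compat_l; [lra|].
        replace (g ^ 4) with (g ^ 2 * g ^ 2) by ring. nra. }
      lra. }
    assert (M ^ 2 <= (a * b * (g / 2)) ^ 2).
    { eapply Rle_trans; [exact T|]. replace ((a * b * (g / 2)) ^ 2) with (a * b * (a * b * (g ^ 2 / 4))) by field.
      apply Rmult_le_compat_l; nra. }
    assert (0 < a * b * (g / 2)) by (repeat apply Rmult_lt_0_compat; lra). nra. }
  assert (F := box_average_le theta beta rho (g / 2) h p h' p' N A B Hh Hh' Hr HW).
  fold a b in F. apply Rmult_le_reg_l in F; [|nra].
  lra.
Qed.

(** * The minor arc case *)

(** The errors scale like the coefficients of a form in the basis and the x_i like those of the
    inverse change of basis, so each product has the same size in s1 s2. The constant is 4 = 1 + 2 +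
    1. *)
Lemma Rabs_form_le (e1 e2 e3 x1 x2 x3 G s1 s2 c : R) : 0 <= c ->
  0 <= G -> 0 <= s1 -> 0 <= s2 ->
  Rabs e1 <= G * s1 ^ 2 -> Rabs e2 <= 2 * G * (s1 * s2) -> Rabs e3 <= G * s2 ^ 2 ->
  Rabs x1 <= c * s2 ^ 2 -> Rabs x2 <= c * (s1 * s2) -> Rabs x3 <= c * s1 ^ 2 ->
  Rabs (e1 * x1 - e2 * x2 + e3 * x3) <= 4 * G * c * (s1 * s2) ^ 2.
Proof.
  intros Hc HG H1 H2 E1 E2 E3 X1 X2 X3.
  eapply Rle_trans; [apply Rabs_triang|].
  eapply Rle_trans; [apply Rplus_le_compat_r, Rabs_triang|].
  rewrite Rabs_Ropp, !Rabs_mult.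
  assert (A1 : Rabs e1 * Rabs x1 <= (G * s1 ^ 2) * (c * s2 ^ 2)) by (apply Rmult_le_compat; auto using Rabs_pos).
  assert (A2 : Rabs e2 * Rabs x2 <= (2 * G * (s1 * s2)) * (c * (s1 * s2))) by (apply Rmult_le_compat; auto using Rabs_pos).
  assert (A3 : Rabs e3 * Rabs x3 <= (G * s2 ^ 2) * (c * s1 ^ 2)) by (apply Rmult_le_compat; auto using Rabs_pos).
  replace (4 * G * c * (s1 * s2) ^ 2) with
    ((G * s1 ^ 2) * (c * s2 ^ 2) + (2 * G * (s1 * s2)) * (c * (s1 * s2)) + (G * s2 ^ 2) * (c * s1 ^ 2)) by ring.
  lra.
Qed.

(* If the form [theta n m] is close to an integral form on the box spanned by a
   reduced basis, let [u n^2 + v n m + w m^2] be that integral form in the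
   coordinates [(n, m)].  The three bounds come from evaluating the difference
   at [(0, 1)], comparing its [n^2] and [m^2] coefficients, and evaluating it
   at [(1, beta)]. *)
Lemma integral_form_of_close (beta theta X r1 r2 G : R) (h1 p1 h2 p2 L1 L2 L3 : Z) :
  1 <= X -> 0 < r1 -> 0 < r2 -> r1 * r2 * X <= 2 -> 0 <= G ->
  ((h1 * p2 - h2 * p1) ^ 2 = 1)%Z ->
  0 <= IZR h1 <= r1 * X -> 0 <= IZR h2 <= r2 * X ->
  Rabs (IZR h1 * beta - IZR p1) <= r1 -> Rabs (IZR h2 * beta - IZR p2) <= r2 ->
  Rabs (theta * (IZR h1 * IZR p1) - IZR L1) <= G * r1 ^ 2 ->
  Rabs (theta * (IZR h1 * IZR p2 + IZR h2 * IZR p1) - IZR L2) <= 2 * G * (r1 * r2) ->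
  Rabs (theta * (IZR h2 * IZR p2) - IZR L3) <= G * r2 ^ 2 ->
  exists u v w : Z,
    Rabs (IZR w) <= 16 * G /\
    Rabs (IZR u - IZR w * beta ^ 2) <= 16 * G * (2 * Rabs beta + 1) / X /\
    Rabs (theta * beta - (IZR u + IZR v * beta + IZR w * beta ^ 2)) <= 16 * G / X ^ 2.
Proof.
  intros HX R1 R2 RX HG D H1 H2 T1 T2 E1 E2 E3.
  (* Substitute a = p2 n - h2 m and b = h1 m - p1 n, up to a common sign, into L1 a^2 + L2 a b + L3
     b^2. The sign disappears because the form is quadratic. *)
  exists (L1 * p2 ^ 2 - L2 * (p1 * p2) + L3 * p1 ^ 2)%Z,
    (- 2 * L1 * (p2 * h2) + L2 * (h1 * p2 + h2 * p1) - 2 * L3 * (p1 * h1))%Z,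
    (L1 * h2 ^ 2 - L2 * (h1 * h2) + L3 * h1 ^ 2)%Z.
  apply (f_equal IZR) in D. change (IZR 1) with 1 in D.
  rewrite <- (pow_IZR _ 2), minus_IZR, !mult_IZR in D.
  repeat rewrite ?plus_IZR, ?minus_IZR, ?mult_IZR, <- ?(pow_IZR _ 2).
  set (a := IZR h1) in *. set (b := IZR h2) in *. set (c := IZR p1) in *. set (d := IZR p2) in *.
  set (e1 := theta * (a * c) - IZR L1) in *.
  set (e2 := theta * (a * d + b * c) - IZR L2) in *.
  set (e3 := theta * (b * d) - IZR L3) in *.
  assert (F1 : IZR L1 = theta * (a * c) - e1) by (unfold e1; ring).
  assert (F2 : IZR L2 = theta * (a * d + b * c) - e2) by (unfold e2; ring).
  assert (F3 : IZR L3 = theta * (b * d) - e3) by (unfold e3; ring).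
  rewrite F1, F2, F3. clearbody e1 e2 e3 a b c d.
  assert (RX2 : (r1 * r2 * X) ^ 2 <= 4) by (assert (0 <= r1 * r2 * X) by (repeat apply Rmult_le_pos; lra); nra).
  assert (S1 := Rabs_pos beta).
  split; [|split].
  - replace (_ + _) with (- (e1 * b ^ 2 - e2 * (a * b) + e3 * a ^ 2)) by ring.
    rewrite Rabs_Ropp. eapply Rle_trans.
    + apply (Rabs_form_le e1 e2 e3 _ _ _ G r1 r2 (X ^ 2)); try assumption; try lra; try nra.
      * rewrite Rabs_pos_eq by nra. replace (X ^ 2 * r2 ^ 2) with ((r2 * X) ^ 2) by ring. apply pow_incr; lra.
      * rewrite Rabs_pos_eq by nra. replace (X ^ 2 * (r1 * r2)) with ((r1 * X) * (r2 * X)) by ring.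
        apply Rmult_le_compat; lra.
      * rewrite Rabs_pos_eq by nra. replace (X ^ 2 * r1 ^ 2) with ((r1 * X) ^ 2) by ring. apply pow_incr; lra.
    + replace (4 * G * X ^ 2 * (r1 * r2) ^ 2) with (4 * G * (r1 * r2 * X) ^ 2) by ring. nra.
  - replace (_ - _) with (- (e1 * (d ^ 2 - beta ^ 2 * b ^ 2) - e2 * (c * d - beta ^ 2 * (a * b))
       + e3 * (c ^ 2 - beta ^ 2 * a ^ 2))) by ring.
    rewrite Rabs_Ropp. set (k := 2 * Rabs beta + 1).
    (* Since y and y' are close to beta x and beta x', the leading terms of size X^2 cancel and only
       X s s' remains. This is the gain of 1 / X in the bound for u - w beta^2. *)
    assert (K : forall x x' y y' s s', 0 < s -> 0 < s' -> 0 <= x <= s * X -> 0 <= x' <= s' * X ->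
       Rabs (x * beta - y) <= s -> Rabs (x' * beta - y') <= s' ->
       Rabs (y * y' - beta ^ 2 * (x * x')) <= (k * X) * (s * s')).
    { intros x x' y y' s s' Ps Ps' Hx Hx' Hy Hy'.
      replace (y * y' - beta ^ 2 * (x * x')) with
        (- (beta * x * (x' * beta - y')) - beta * x' * (x * beta - y) + (x * beta - y) * (x' * beta - y')) by ring.
      eapply Rle_trans; [apply Rabs_triang|].
      eapply Rle_trans; [apply Rplus_le_compat_r, Rabs_triang|].
      rewrite !Rabs_Ropp, !Rabs_mult, (Rabs_pos_eq x), (Rabs_pos_eq x') by lra.
      assert (Rabs beta * x * Rabs (x' * beta - y') <= Rabs beta * (s * X) * s').
      { apply Rmult_le_compat; auto using Rabs_pos; [apply Rmult_le_pos; lra|apply Rmult_le_compat_l; lra]. }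
      assert (Rabs beta * x' * Rabs (x * beta - y) <= Rabs beta * (s' * X) * s).
      { apply Rmult_le_compat; auto using Rabs_pos; [apply Rmult_le_pos; lra|apply Rmult_le_compat_l; lra]. }
      assert (Rabs (x * beta - y) * Rabs (x' * beta - y') <= s * s') by (apply Rmult_le_compat; auto using Rabs_pos).
      assert (s * s' <= X * (s * s')) by (assert (0 <= s * s') by (apply Rmult_le_pos; lra); nra).
      unfold k. lra. }
    eapply Rle_trans.
    + apply (Rabs_form_le e1 e2 e3 _ _ _ G r1 r2 (k * X)); try assumption; try lra.
      * unfold k; apply Rmult_le_pos; lra.
      * replace (d ^ 2) with (d * d) by ring. replace (b ^ 2) with (b * b) by ring.
        replace (r2 ^ 2) with (r2 * r2) by ring. apply K; assumption.
      * apply K; assumption.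
      * replace (c ^ 2) with (c * c) by ring. replace (a ^ 2) with (a * a) by ring.
        replace (r1 ^ 2) with (r1 * r1) by ring. apply K; assumption.
    + apply Rmult_le_reg_r with X; [lra|].
      replace (16 * G * k / X * X) with (4 * (G * k) * 4) by (field; lra).
      replace (4 * G * (k * X) * (r1 * r2) ^ 2 * X) with (4 * (G * k) * (r1 * r2 * X) ^ 2) by ring.
      apply Rmult_le_compat_l; [|assumption]. unfold k. repeat apply Rmult_le_pos; lra.
  - replace (theta * beta) with (theta * beta * (a * d - b * c) ^ 2) by (rewrite D; ring).
    replace (_ - _) with (e1 * (b * beta - d) ^ 2 - e2 * ((a * beta - c) * (b * beta - d))
      + e3 * (a * beta - c) ^ 2) by ring.
    eapply Rle_trans.
    + apply (Rabs_form_le e1 e2 e3 _ _ _ G r1 r2 1); try assumption; try lra; rewrite Rmult_1_l.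
      * rewrite <- RPow_abs. apply pow_incr; split; [apply Rabs_pos|assumption].
      * rewrite Rabs_mult. apply Rmult_le_compat; auto using Rabs_pos.
      * rewrite <- RPow_abs. apply pow_incr; split; [apply Rabs_pos|assumption].
    + apply Rmult_le_reg_r with (X ^ 2); [nra|].
      replace (16 * G / X ^ 2 * X ^ 2) with (4 * G * 4) by (field; lra).
      replace (4 * G * 1 * (r1 * r2) ^ 2 * X ^ 2) with (4 * G * (r1 * r2 * X) ^ 2) by ring.
      apply Rmult_le_compat_l; lra.
Qed.

(** A direction of length r admits about g / (64 r) harmless shifts, so A B is of order g^2 / (r r')
    and the error of the rational approximation is proportional to r r'. Numerical constants are
    absorbed by powers of 1 / g >= 64. *)
Lemma pair_rational (theta beta X g : R) (h p h' p' : Z) (r r' : R) (N : nat) :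
  0 < g -> g <= / 64 -> X <= 2 * INR N ->
  (forall rho, 0 <= rho -> bad_count beta rho N <= (4 * rho + g / 16) * INR N) ->
  0 < r <= g ^ 5 / 2 ^ 18 -> 0 < r' <= g ^ 5 / 2 ^ 18 ->
  0 <= IZR h <= r * X -> 0 <= IZR h' <= r' * X ->
  Rabs (IZR h * beta - IZR p) <= r -> Rabs (IZR h' * beta - IZR p') <= r' ->
  g * INR N < Cmod (Csum (seq 1 N) (fun n => e (- theta * INR n * IZR (Zfloor (beta * INR n))))) ->
  exists j l : Z, (1 <= j)%Z /\ IZR j <= (/ g) ^ 3 /\
    Rabs (IZR j * (theta * (IZR h * IZR p' + IZR h' * IZR p)) - IZR l) <= (/ g) ^ 11 * (r * r').
Proof.
  intros Hg Hg' HX Hbad Hr Hr' Hh Hh' Ht Ht' HS.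
  (* The side is the floor of y = g / (64 s). The upper bound on s makes y >= 4096 / g^4, and y >= 2
     lets the floor lose at most half of y. *)
  assert (A0 : forall s, 0 < s <= g ^ 5 / 2 ^ 18 ->
    exists A : nat, INR A * s <= g / 64 /\ 2048 / g ^ 4 <= INR A /\ g <= 128 * (INR A * s)).
  { intros s Hs. exists (Z.to_nat (Zfloor (g / (64 * s)))).
    set (y := g / (64 * s)). assert (B := Zfloor_bound y).
    assert (Ey : y * s = g / 64) by (unfold y; field; lra).
    assert (G4 : 0 < g ^ 4) by (apply pow_lt; lra).
    assert (G4' : g ^ 4 <= 1) by (rewrite <- (pow1 4); apply pow_incr; lra).
    assert (Y : 4096 / g ^ 4 <= y).
    { apply Rmult_le_reg_r with s; [lra|]. rewrite Ey.
      apply Rle_trans with (4096 / g ^ 4 * (g ^ 5 / 2 ^ 18)).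
      - apply Rmult_le_compat_l; [apply Rdiv_le_0_compat; lra|lra].
      - right; field; lra. }
    assert (M : 4096 <= 4096 / g ^ 4).
    { apply Rmult_le_reg_r with (g ^ 4); [lra|]. unfold Rdiv. rewrite Rmult_assoc, Rinv_l; lra. }
    assert (Z0 : (0 <= Zfloor y)%Z) by (apply Zfloor_lub; lra).
    rewrite INR_IZR_INZ, Z2Nat.id by assumption.
    repeat split.
    - rewrite <- Ey. apply Rmult_le_compat_r; lra.
    - lra.
    - assert (y / 2 * s <= IZR (Zfloor y) * s) by (apply Rmult_le_compat_r; lra). lra. }
  destruct (A0 r Hr) as (A & A1 & A2 & A3). destruct (A0 r' Hr') as (B & B1 & B2 & B3).
  assert (PA := pos_INR A). assert (PB := pos_INR B).
  assert (Hh0 : (0 <= h)%Z) by (apply le_IZR; lra). assert (Hh0' : (0 <= h')%Z) by (apply le_IZR; lra).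
  assert (PN := pos_INR N).
  assert (X0 : 0 <= X) by nra.
  assert (C1 : INR A * IZR h <= g / 64 * X).
  { apply Rle_trans with (INR A * (r * X)); [apply Rmult_le_compat_l; lra|].
    rewrite <- Rmult_assoc. apply Rmult_le_compat_r; lra. }
  assert (C2 : INR B * IZR h' <= g / 64 * X).
  { apply Rle_trans with (INR B * (r' * X)); [apply Rmult_le_compat_l; lra|].
    rewrite <- Rmult_assoc. apply Rmult_le_compat_r; lra. }
  (* With rho = g / 32 the shift lengths lose at most g N / 8 and the bad n at most 3 g N / 8,
     together exactly the permitted g N / 2. *)
  destruct (large_sum_rational theta beta (g / 32) g h p h' p' N A B) as (j & l & J1 & J2 & J3); try assumption.
  - assert (INR A * Rabs (IZR h * beta - IZR p) <= INR A * r) by (apply Rmult_le_compat_l; lra).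
    assert (INR B * Rabs (IZR h' * beta - IZR p') <= INR B * r') by (apply Rmult_le_compat_l; lra).
    lra.
  - assert (Hb := Hbad (g / 32) ltac:(lra)).
    assert (g * X <= g * (2 * INR N)) by (apply Rmult_le_compat_l; lra). lra.
  - assert (Hd : 64 <= / g).
    { rewrite <- (Rinv_inv 64). apply Rinv_le_contravar; lra. }
    assert (D8 : 0 < (/ g) ^ 8) by (apply pow_lt; lra).
    assert (D2 : 0 < (/ g) ^ 2) by (apply pow_lt; lra).
    exists j, l. repeat split; [assumption| |].
    + eapply Rle_trans; [exact J2|]. replace (64 / g ^ 2) with ((/ g) ^ 2 * 64) by (field; lra).
      replace ((/ g) ^ 3) with ((/ g) ^ 2 * / g) by ring. apply Rmult_le_compat_l; lra.
    + eapply Rle_trans; [exact J3|].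
      assert (P1 : 0 < INR A) by nra. assert (P2 : 0 < INR B) by nra.
      assert (G : g * g <= 128 * (INR A * r) * (128 * (INR B * r'))) by (apply Rmult_le_compat; lra).
      apply Rmult_le_reg_r with (g ^ 8 * (INR A * INR B)).
      { repeat apply Rmult_lt_0_compat; lra. }
      replace (2 / (g ^ 6 * (INR A * INR B)) * (g ^ 8 * (INR A * INR B))) with (2 * (g * g)) by (field; lra).
      replace ((/ g) ^ 11 * (r * r') * (g ^ 8 * (INR A * INR B)))
        with ((/ g) ^ 3 * ((INR A * r) * (INR B * r'))) by (field; lra).
      assert (64 ^ 3 <= (/ g) ^ 3) by (apply pow_incr; lra).
      assert (0 <= INR A * r * (INR B * r')) by (repeat apply Rmult_le_pos; lra).
      apply Rle_trans with (64 ^ 3 * (INR A * r * (INR B * r'))); [lra|].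
      apply Rmult_le_compat_r; lra.
Qed.

Lemma major_arc_of_large_sum (theta beta X g : R) (h1 p1 h2 p2 : Z) (r1 r2 : R) (N : nat) :
  0 < g -> g <= / 64 -> 1 <= X -> X <= 2 * INR N -> beta <> 0 ->
  (forall rho, 0 <= rho -> bad_count beta rho N <= (4 * rho + g / 16) * INR N) ->
  0 < r1 -> r1 <= r2 -> r2 <= g ^ 5 / 2 ^ 18 -> r1 * r2 * X <= 2 ->
  ((h1 * p2 - h2 * p1) ^ 2 = 1)%Z ->
  0 <= IZR h1 <= r1 * X -> 0 <= IZR h2 <= r2 * X ->
  Rabs (IZR h1 * beta - IZR p1) <= r1 -> Rabs (IZR h2 * beta - IZR p2) <= r2 ->
  (forall u w : Z, w <> 0%Z -> Rabs (IZR w) <= 16 * (/ g) ^ 17 ->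
    16 * (/ g) ^ 17 * (2 * Rabs beta + 1) / X < Rabs (IZR u - IZR w * beta ^ 2)) ->
  16 * (/ g) ^ 17 * (2 * Rabs beta + 1) / X < 1 ->
  g * INR N < Cmod (Csum (seq 1 N) (fun n => e (- theta * INR n * IZR (Zfloor (beta * INR n))))) ->
  exists a q : Z, (1 <= q)%Z /\ IZR q <= 2 * (/ g) ^ 9 /\
    Rabs (theta - IZR a / IZR q) <= 16 * (/ g) ^ 17 / Rabs beta / X ^ 2.
Proof.
  intros Hg Hg' HX HXN Hbeta Hbad R1 R12 R2 RX D H1 H2 T1 T2 Dio HX1 HS.
  assert (Hd : 64 <= / g) by (rewrite <- (Rinv_inv 64); apply Rinv_le_contravar; lra).
  destruct (pair_rational theta beta X g h1 p1 h1 p1 r1 r1 N) as (j1 & l1 & J1 & K1 & E1); try assumption; try lra.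
  destruct (pair_rational theta beta X g h1 p1 h2 p2 r1 r2 N) as (j2 & l2 & J2 & K2 & E2); try assumption; try lra.
  destruct (pair_rational theta beta X g h2 p2 h2 p2 r2 r2 N) as (j3 & l3 & J3 & K3 & E3); try assumption; try lra.
  set (d := / g) in *.
  assert (D3 : 0 < d ^ 3) by (apply pow_lt; lra).
  assert (D11 : 0 < d ^ 11) by (apply pow_lt; lra).
  assert (D17 : 0 < d ^ 17) by (apply pow_lt; lra).
  (* Eleven powers come from [pair_rational], and six from multiplying each relation by the other
     two denominators. *)
  set (G := d ^ 17) in *.
  (* The factor 2 is there because a diagonal pair controls 2 theta h p, while the form itself has
     the coefficient theta h p. *)
  set (q := (2 * (j1 * j2 * j3))%Z).
  assert (J1' := IZR_le _ _ J1). assert (J2' := IZR_le _ _ J2). assert (J3' := IZR_le _ _ J3).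
  assert (Kp : forall x y, 1 <= x <= d ^ 3 -> 1 <= y <= d ^ 3 -> 1 <= x * y <= d ^ 6).
  { intros x y Hx Hy. split; [nra|]. replace (d ^ 6) with (d ^ 3 * d ^ 3) by ring. apply Rmult_le_compat; lra. }
  assert (K12 := Kp _ _ (conj J1' K1) (conj J2' K2)). assert (K13 := Kp _ _ (conj J1' K1) (conj J3' K3)).
  assert (K23 := Kp _ _ (conj J2' K2) (conj J3' K3)).
  assert (Err : forall k x s, 1 <= k <= d ^ 6 -> 0 <= s -> Rabs x <= d ^ 11 * s -> Rabs (k * x) <= G * s).
  { intros k x s Hk Hs Hx. rewrite Rabs_mult, (Rabs_pos_eq k) by lra.
    unfold G. replace (d ^ 17 * s) with (d ^ 6 * (d ^ 11 * s)) by ring.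
    apply Rmult_le_compat; auto using Rabs_pos; lra. }
  destruct (integral_form_of_close beta (IZR q * theta) X r1 r2 G h1 p1 h2 p2
     (j2 * j3 * l1) (2 * (j1 * j3 * l2)) (j1 * j2 * l3)) as (u & v & w & W & U & V); try assumption; try lra.
  - unfold q. rewrite !mult_IZR. replace (r1 ^ 2) with (r1 * r1) by ring.
    replace (_ - _) with (IZR j2 * IZR j3 * (IZR j1 * (theta * (IZR h1 * IZR p1 + IZR h1 * IZR p1)) - IZR l1)) by ring.
    apply Err; [assumption|nra|assumption].
  - unfold q. rewrite !mult_IZR.
    replace (_ - _) with (2 * (IZR j1 * IZR j3 * (IZR j2 * (theta * (IZR h1 * IZR p2 + IZR h2 * IZR p1)) - IZR l2))) by ring.
    rewrite Rabs_mult, (Rabs_pos_eq 2) by lra. replace (2 * G * (r1 * r2)) with (2 * (G * (r1 * r2))) by ring.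
    apply Rmult_le_compat_l; [lra|].
    apply Err; [assumption|nra|assumption].
  - unfold q. rewrite !mult_IZR. replace (r2 ^ 2) with (r2 * r2) by ring.
    replace (_ - _) with (IZR j1 * IZR j2 * (IZR j3 * (theta * (IZR h2 * IZR p2 + IZR h2 * IZR p2)) - IZR l3)) by ring.
    apply Err; [assumption|nra|assumption].
  - assert (w = 0%Z).
    { destruct (Z.eq_dec w 0) as [|Nw]; [assumption|exfalso].
      specialize (Dio u w Nw W). lra. }
    subst w.
    assert (u = 0%Z).
    { rewrite Rmult_0_l, Rminus_0_r in U. assert (Hu : Rabs (IZR u) < 1) by lra.
      rewrite <- abs_IZR in Hu. apply lt_IZR in Hu. lia. }
    subst u.
    assert (Hq : (1 <= q)%Z) by (unfold q; nia).
    exists v, q. split; [assumption|]. split.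
    + unfold q. rewrite !mult_IZR. apply Rmult_le_compat_l; [lra|].
      replace (d ^ 9) with (d ^ 6 * d ^ 3) by ring. apply Rmult_le_compat; lra.
    + assert (Hq' := IZR_le _ _ Hq).
      assert (Hb : 0 < Rabs beta) by (apply Rabs_pos_lt; assumption).
      replace (IZR q * theta * beta - (0 + IZR v * beta + 0 * beta ^ 2))
        with (IZR q * beta * (theta - IZR v / IZR q)) in V by (field; lra).
      rewrite !Rabs_mult, (Rabs_pos_eq (IZR q)) in V by lra.
      apply Rmult_le_reg_r with (Rabs beta * X ^ 2); [apply Rmult_lt_0_compat; [assumption|nra]|].
      replace (16 * G / Rabs beta / X ^ 2 * (Rabs beta * X ^ 2)) with (16 * G) by (field; lra).
      apply Rmult_le_compat_r with (r := X ^ 2) in V; [|nra].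
      replace (16 * G / X ^ 2 * X ^ 2) with (16 * G) in V by (field; lra).
      set (t := Rabs (theta - IZR v / IZR q)) in *.
      assert (0 <= t * (Rabs beta * X ^ 2)).
      { repeat apply Rmult_le_pos; try apply Rabs_pos; nra. }
      replace (IZR q * Rabs beta * t * X ^ 2) with (IZR q * (t * (Rabs beta * X ^ 2))) in V by ring.
      nra.
Qed.

(** * The major arc case *)

Lemma NoDup_list_prod {T U} (l : list T) (l' : list U) :
  NoDup l -> NoDup l' -> NoDup (list_prod l l').
Proof.
  intros N N'. induction l as [|x l IH]; simpl; [constructor|].
  apply NoDup_cons_iff in N as [Nx N].
  apply NoDup_app; [|auto|].
  - apply NoDup_map_in; [assumption|]. intros; congruence.
  - intros [y z] H1 H2. apply in_map_iff in H1 as [w [E _]]. injection E; intros; subst.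
    apply in_prod_iff in H2 as [H2 _]. contradiction.
Qed.

(** The row x = 0 contributes q. For 0 < x < q the number e(-c x / q) is a nontrivial q-th root of
    unity, so its powers sum to 0. *)
Lemma complete_hyperbola_sum (c : Z) (q : nat) : (0 < q)%nat -> Z.gcd c (Z.of_nat q) = 1%Z ->
  Csum (seq 0 q) (fun x => Csum (seq 0 q) (fun y => e (- (IZR c / INR q) * (INR x * INR y)))) = INR q.
Proof.
  intros Hq Hg. destruct q as [|q']; [lia|]. set (q := S q') in *.
  assert (Hq' : 0 < INR q) by (apply lt_0_INR; assumption).
  change (seq 0 q) with (0%nat :: seq 1 q') at 1. rewrite Csum_cons.
  rewrite (Csum_ext _ (fun y => e (- (IZR c / INR q) * (INR 0 * INR y))) (fun _ => RtoC 1)).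
  2:{ intros y _. rewrite Rmult_0_l, Rmult_0_r. apply e_0. }
  rewrite Csum_const, length_seq.
  rewrite (Csum_ext _ _ (fun _ => RtoC 0)), Csum_0; [ring|].
  intros x Hx. apply in_seq in Hx.
  set (xi := - (IZR c / INR q) * INR x).
  rewrite (Csum_ext _ _ (fun y => e (xi * INR y))).
  2:{ intros y _. unfold xi. f_equal; ring. }
  assert (G := geometric_sum xi q).
  replace (xi * INR q) with (IZR (- c * Z.of_nat x)) in G.
  2:{ unfold xi. rewrite mult_IZR, opp_IZR, <- INR_IZR_INZ. field; lra. }
  rewrite e_IZR in G. replace (1 - 1)%C with (RtoC 0) in G by ring.
  apply (f_equal Cmod) in G. rewrite Cmod_mult, Cmod_0 in G.
  apply Rmult_integral in G as [G|G]; [exfalso|apply Cmod_eq_0; exact G].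
  (* If the geometric ratio were 1, then xi would be an integer, so q would divide c x and hence
     x. *)
  assert (L := Cmod_e_minus_1_ge xi). rewrite G in L.
  assert (Z0 := dist_int_ge0 xi). assert (E : dist_int xi = 0) by lra.
  unfold dist_int in E. apply Rabs_eq_0 in E. set (z := Zfloor _) in E.
  assert (E' : IZR (- c * Z.of_nat x) = IZR (z * Z.of_nat q)).
  { rewrite !mult_IZR, opp_IZR, <- !INR_IZR_INZ. unfold xi in E.
    replace (IZR z) with (- (IZR c / INR q) * INR x) by lra. field; lra. }
  apply eq_IZR in E'.
  assert (D : (Z.of_nat q | c * Z.of_nat x)%Z) by (exists (- z)%Z; lia).
  apply Z.gauss in D; [|rewrite Z.gcd_comm; assumption].
  apply Z.divide_pos_le in D; lia.
Qed.

(* A unimodular change of basis permutes [(Z/q)^2], which turns the sum into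
   a complete hyperbola sum. *)
Lemma complete_box_sum (c n m h1 p1 h2 p2 : Z) (q : nat) :
  (0 < q)%nat -> Z.gcd c (Z.of_nat q) = 1%Z -> ((h1 * p2 - h2 * p1) ^ 2 = 1)%Z ->
  Csum (seq 0 q) (fun a => Csum (seq 0 q) (fun b =>
    e (- (IZR c / INR q) * (IZR (n + (Z.of_nat a * h1 + Z.of_nat b * h2))
       * IZR (m + (Z.of_nat a * p1 + Z.of_nat b * p2)))))) = INR q.
Proof.
  intros Hq Hg D. set (Q := Z.of_nat q) in *.
  set (Phi := fun v : nat * nat => e (- (IZR c / INR q) * (INR (fst v) * INR (snd v)))).
  set (phi := fun v : nat * nat =>
    (Z.to_nat ((n + (Z.of_nat (fst v) * h1 + Z.of_nat (snd v) * h2)) mod Q),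
     Z.to_nat ((m + (Z.of_nat (fst v) * p1 + Z.of_nat (snd v) * p2)) mod Q))).
  set (L := list_prod (seq 0 q) (seq 0 q)).
  assert (HQ : (0 < Q)%Z) by (unfold Q; lia).
  assert (Hq' : INR q <> 0) by (apply not_0_INR; lia).
  transitivity (Csum L (fun v => Phi (phi v))).
  { unfold L. rewrite Csum_list_prod. apply Csum_ext; intros a _. apply Csum_ext; intros b _.
    unfold Phi, phi; cbn [fst snd].
    set (x := (n + (Z.of_nat a * h1 + Z.of_nat b * h2))%Z).
    set (y := (m + (Z.of_nat a * p1 + Z.of_nat b * p2))%Z).
    assert (Ex := Z.div_mod x Q ltac:(lia)). assert (Ey := Z.div_mod y Q ltac:(lia)).
    rewrite !INR_IZR_INZ, !Z2Nat.id by (apply Z.mod_pos_bound; assumption).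
    (* The product x y differs from that of the residues by Q times an integer, so the phases differ
       by an integer. *)
    fold Q. rewrite <- (e_shift _ (c * ((x / Q) * y + (x mod Q) * (y / Q)))). f_equal.
    assert (E : IZR x * IZR y = IZR (x mod Q) * IZR (y mod Q) + IZR Q * IZR ((x / Q) * y + (x mod Q) * (y / Q))).
    { rewrite <- !mult_IZR, <- plus_IZR. f_equal. nia. }
    rewrite E, mult_IZR. unfold Q. rewrite <- INR_IZR_INZ. field. assumption. }
  rewrite <- (Csum_map L phi Phi).
  rewrite (Csum_perm _ L).
  { unfold L. rewrite Csum_list_prod. apply complete_hyperbola_sum; assumption. }
  (* An injective map of a finite set into itself is a permutation. *)
  apply NoDup_Permutation_bis.
  - apply NoDup_map_in; [apply NoDup_list_prod; apply seq_NoDup|].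
    intros [a b] [a' b'] H H' E. unfold L in H, H'. rewrite in_prod_iff, !in_seq in H, H'.
    unfold phi in E; cbn [fst snd] in E. injection E as E1 E2.
    apply Z2Nat.inj in E1; [|apply Z.mod_pos_bound; assumption|apply Z.mod_pos_bound; assumption].
    apply Z2Nat.inj in E2; [|apply Z.mod_pos_bound; assumption|apply Z.mod_pos_bound; assumption].
    apply Z.cong_iff_0, Z.mod_divide in E1 as [k1 E1]; [|lia].
    apply Z.cong_iff_0, Z.mod_divide in E2 as [k2 E2]; [|lia].
    set (da := (Z.of_nat a - Z.of_nat a')%Z). set (db := (Z.of_nat b - Z.of_nat b')%Z).
    assert (F1 : (da * h1 + db * h2 = k1 * Q)%Z) by (unfold da, db; lia).
    assert (F2 : (da * p1 + db * p2 = k2 * Q)%Z) by (unfold da, db; lia).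
    set (dt := (h1 * p2 - h2 * p1)%Z) in *.
    (* Cramer's rule, with [dt] as its own inverse because dt^2 = 1. Both differences are then
       multiples of Q smaller than Q in absolute value. *)
    assert (G1 : (da = dt * (k1 * p2 - k2 * h2) * Q)%Z).
    { transitivity (dt ^ 2 * da)%Z; [rewrite D; ring|].
      transitivity (dt * (p2 * (da * h1 + db * h2) - h2 * (da * p1 + db * p2)))%Z; [unfold dt; ring|].
      rewrite F1, F2; ring. }
    assert (G2 : (db = dt * (k2 * h1 - k1 * p1) * Q)%Z).
    { transitivity (dt ^ 2 * db)%Z; [rewrite D; ring|].
      transitivity (dt * (h1 * (da * p1 + db * p2) - p1 * (da * h1 + db * h2)))%Z; [unfold dt; ring|].
      rewrite F1, F2; ring. }
    assert (B1 : (Z.abs da < Q)%Z) by (unfold da, Q; lia).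
    assert (B2 : (Z.abs db < Q)%Z) by (unfold db, Q; lia).
    assert (Hz : forall x k, (Z.abs x < Q -> x = k * Q -> x = 0)%Z).
    { intros x k Hx Ek. destruct (Z.eq_dec k 0) as [->|Nk]; [lia|nia]. }
    assert (da = 0%Z) by exact (Hz _ _ B1 G1). assert (db = 0%Z) by exact (Hz _ _ B2 G2).
    f_equal; [unfold da in *|unfold db in *]; lia.
  - rewrite length_map. lia.
  - intros v Hv. apply in_map_iff in Hv as [[a b] [<- _]]. unfold phi, L; cbn [fst snd].
    apply in_prod; apply in_seq.
    + assert (B := Z.mod_pos_bound (n + (Z.of_nat a * h1 + Z.of_nat b * h2)) Q HQ). unfold Q in *; lia.
    + assert (B := Z.mod_pos_bound (m + (Z.of_nat a * p1 + Z.of_nat b * p2)) Q HQ). unfold Q in *; lia.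
Qed.

Lemma ex_RInt_e_quadratic (t a b : R) :
  ex_RInt (V := C_R_NormedModule) (fun v => e (t * v ^ 2)) a b.
Proof.
  exists (RInt (fun v => cos (2 * PI * (t * v ^ 2))) a b, RInt (fun v => sin (2 * PI * (t * v ^ 2))) a b).
  apply (is_RInt_fct_extend_pair (U := R_NormedModule) (V := R_NormedModule) (fun v => e (t * v ^ 2)));
  apply (RInt_correct (V := R_CompleteNormedModule)), ex_RInt_continuous; intros z _; simpl.
  - apply (ex_derive_continuous (fun v => cos (2 * PI * (t * (v * (v * 1)))))). auto_derive; auto.
  - apply (ex_derive_continuous (fun v => sin (2 * PI * (t * (v * (v * 1)))))). auto_derive; auto.
Qed.

Lemma norm_C_R (z : C) : norm (z : C_R_NormedModule) = Cmod z.
Proof.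
  destruct z as [x y]. unfold Cmod; simpl. unfold norm; simpl. unfold prod_norm; simpl.
  unfold norm; simpl. unfold abs; simpl.
  f_equal. rewrite !Rmult_1_r, <- !Rabs_mult, !Rabs_pos_eq by nra. reflexivity.
Qed.

(** With z a value of the integrand this compares one term of a sum with the integral over a unit
    interval; with z = 0 it is the trivial bound. *)
Lemma Cmod_CInt_le (t a b c : R) (z : C) : a <= b ->
  (forall v, a <= v <= b -> Cmod (z - e (t * v ^ 2)) <= c) ->
  Cmod (RtoC (b - a) * z - CInt (fun v => e (t * v ^ 2)) a b) <= (b - a) * c.
Proof.
  intros Hab H.
  assert (I := is_RInt_minus (V := C_R_NormedModule) (fun _ => z) (fun v => e (t * v ^ 2)) a b _ _
    (is_RInt_const (V := C_R_NormedModule) a b z)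
    (RInt_correct (V := C_R_CompleteNormedModule) _ _ _ (ex_RInt_e_quadratic t a b))).
  apply norm_RInt_le_const with (M := c) in I; [|assumption|].
  - rewrite norm_C_R in I. eapply Rle_trans; [|exact I]. right. f_equal.
    unfold CInt. unfold minus, plus, opp, scal; simpl. unfold prod_plus, prod_opp, prod_scal, Cminus, Cplus, Copp, Cmult; simpl.
    unfold plus, opp, scal; simpl. unfold mult; simpl. f_equal; ring.
  - intros v Hv. rewrite norm_C_R. apply (H v Hv).
Qed.

Lemma CInt_Chasles (t a b c : R) :
  (CInt (fun v => e (t * v ^ 2)) a b + CInt (fun v => e (t * v ^ 2)) b c
   = CInt (fun v => e (t * v ^ 2)) a c)%C.
Proof.
  exact (RInt_Chasles (V := C_R_CompleteNormedModule) _ _ _ _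
    (ex_RInt_e_quadratic t a b) (ex_RInt_e_quadratic t b c)).
Qed.

Lemma CInt_point (t a : R) : CInt (fun v => e (t * v ^ 2)) a a = 0.
Proof. exact (RInt_point (V := C_R_CompleteNormedModule) a _). Qed.

(** On a unit interval below N the phase varies by at most 2 |t| N, hence e by 16 |t| N; this is
    summed over N intervals. The final 1 pays for the stretch from N to X. *)
Lemma Riemann_sum_e_quadratic (t X : R) (N : nat) : INR N <= X <= INR N + 1 ->
  Cmod (Csum (seq 1 N) (fun n => e (t * INR n ^ 2)) - CInt (fun v => e (t * v ^ 2)) 0 X)
  <= 16 * Rabs t * INR N ^ 2 + 1.
Proof.
  intros HX.
  assert (K : forall k, (k <= N)%nat ->
    Cmod (Csum (seq 1 k) (fun n => e (t * INR n ^ 2)) - CInt (fun v => e (t * v ^ 2)) 0 (INR k))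
    <= INR k * (16 * Rabs t * INR N)).
  { induction k as [|k IH]; intros Hk.
    - simpl INR. rewrite CInt_point. unfold Csum; simpl. replace (0 - 0)%C with (RtoC 0) by ring.
      rewrite Cmod_0; lra.
    - rewrite Csum_seq_S, <- (CInt_Chasles t 0 (INR k) (INR (S k))).
      assert (B := Cmod_CInt_le t (INR k) (INR (S k)) (16 * Rabs t * INR N) (e (t * INR (S k) ^ 2))).
      assert (P := pos_INR k). assert (Q := le_INR _ _ Hk). rewrite S_INR in *.
      replace (INR k + 1 - INR k) with 1 in B by ring.
      assert (B' : Cmod (1 * e (t * (INR k + 1) ^ 2) - CInt (fun v => e (t * v ^ 2)) (INR k) (INR k + 1))
         <= 1 * (16 * Rabs t * INR N)).
      { apply B; [lra|]. intros v Hv. eapply Rle_trans; [apply e_lipschitz|].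
        replace (_ - _) with (t * ((INR k + 1 - v) * (INR k + 1 + v))) by ring.
        rewrite !Rabs_mult, (Rabs_pos_eq (_ - v)), (Rabs_pos_eq (_ + v)) by lra.
        assert ((INR k + 1 - v) * (INR k + 1 + v) <= 1 * (2 * INR N)) by (apply Rmult_le_compat; lra).
        assert (T := Rabs_pos t). nra. }
      specialize (IH ltac:(lia)).
      change (1 + k)%nat with (S k). rewrite S_INR.
      match goal with |- Cmod (?s + ?x - (?i1 + ?i2)) <= _ =>
        replace (s + x - (i1 + i2))%C with ((s - i1) + (1 * x - i2))%C by ring end.
      eapply Rle_trans; [apply Cmod_triangle|]. lra. }
  specialize (K N (le_n N)).
  rewrite <- (CInt_Chasles t 0 (INR N) X).
  assert (B := Cmod_CInt_le t (INR N) X 1 0 ltac:(lra)).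
  assert (B' : Cmod (RtoC (X - INR N) * 0 - CInt (fun v => e (t * v ^ 2)) (INR N) X) <= (X - INR N) * 1).
  { apply B. intros v _. replace (0 - e (t * v ^ 2))%C with (- e (t * v ^ 2))%C by ring.
    rewrite Cmod_opp, Cmod_e. lra. }
  match goal with |- Cmod (?s - (?i1 + ?i2)) <= _ =>
    replace (s - (i1 + i2))%C with ((s - i1) + (RtoC (X - INR N) * 0 - i2))%C by ring end.
  eapply Rle_trans; [apply Cmod_triangle|]. lra.
Qed.

(** In a shifted term the phase splits into (c / q) x y and t x y. The latter is replaced by t beta
    n^2, which does not depend on the shift, so the box sum of the former can be evaluated: it is q
    for every n, out of q^2 shifts. *)
Lemma major_arc_sum (theta beta t rho : R) (c h1 p1 h2 p2 : Z) (q N : nat) :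
  (0 < q)%nat -> Z.gcd c (Z.of_nat q) = 1%Z -> theta = IZR c / INR q + t ->
  (0 <= h1)%Z -> (0 <= h2)%Z -> ((h1 * p2 - h2 * p1) ^ 2 = 1)%Z ->
  INR q * Rabs (IZR h1 * beta - IZR p1) + INR q * Rabs (IZR h2 * beta - IZR p2) <= rho ->
  let s := INR q * IZR h1 + INR q * IZR h2 in
  Cmod (INR q * Csum (seq 1 N) (fun n => e (- theta * INR n * IZR (Zfloor (beta * INR n))))
    - Csum (seq 1 N) (fun n => e (- (beta * t) * INR n ^ 2)))
  <= INR q * (2 * s + 2 * bad_count beta rho N
     + INR N * (8 * Rabs t * ((INR N + s) * (1 + rho) + Rabs beta * s * (2 * INR N + s)))).
Proof.
  intros Hq Hg Eth Hh1 Hh2 D Hr s.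
  set (V := (INR N + s) * (1 + rho) + Rabs beta * s * (2 * INR N + s)).
  set (S := Csum (seq 1 N) _). set (T := Csum (seq 1 N) _).
  assert (Hq' : 0 < INR q) by (apply lt_0_INR; assumption).
  set (x := fun n a b : nat => (Z.of_nat n + (Z.of_nat a * h1 + Z.of_nat b * h2))%Z).
  set (y := fun n a b : nat => (Zfloor (beta * INR n) + (Z.of_nat a * p1 + Z.of_nat b * p2))%Z).
  set (U := fun n a b : nat => (e (- (IZR c / INR q) * (IZR (x n a b) * IZR (y n a b))) * e (- (beta * t) * INR n ^ 2))%C).
  assert (H1 := IZR_le _ _ Hh1). assert (H2 := IZR_le _ _ Hh2).
  assert (PN := pos_INR N).
  assert (s0 : 0 <= s) by (unfold s; assert (0 <= INR q * IZR h1) by (apply Rmult_le_pos; lra);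
    assert (0 <= INR q * IZR h2) by (apply Rmult_le_pos; lra); lra).
  assert (C1 : forall n a b, In n (seq 1 N) -> In a (seq 0 q) -> In b (seq 0 q) ->
    Cmod (box_term theta beta h1 p1 h2 p2 n a b - U n a b) <= 8 * Rabs t * V).
  { intros n a b Hn Ha Hb. apply in_seq in Hn, Ha, Hb.
    set (s' := INR a * IZR h1 + INR b * IZR h2).
    assert (Ex : IZR (x n a b) = INR n + s').
    { unfold x, s'. rewrite !plus_IZR, !mult_IZR, <- !INR_IZR_INZ. ring. }
    assert (Ey : IZR (y n a b) = IZR (Zfloor (beta * INR n)) + (INR a * IZR p1 + INR b * IZR p2)).
    { unfold y. rewrite !plus_IZR, !mult_IZR, <- !INR_IZR_INZ. ring. }
    replace (box_term theta beta h1 p1 h2 p2 n a b) with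
      (e (- (IZR c / INR q) * (IZR (x n a b) * IZR (y n a b))) * e (- t * (IZR (x n a b) * IZR (y n a b))))%C.
    2:{ rewrite <- e_plus. unfold box_term. f_equal. rewrite Ex, Ey, Eth. unfold s'. ring. }
    unfold U.
    match goal with |- Cmod (?p * ?u - ?p * ?w) <= _ => replace (p * u - p * w)%C with (p * (u - w))%C by ring end.
    rewrite Cmod_mult, Cmod_e, Rmult_1_l. eapply Rle_trans; [apply e_lipschitz|].
    rewrite Rmult_assoc. apply Rmult_le_compat_l; [lra|].
    replace (_ - _) with (- t * (IZR (x n a b) * IZR (y n a b) - beta * INR n ^ 2)) by ring.
    rewrite Rabs_mult, Rabs_Ropp. apply Rmult_le_compat_l; [apply Rabs_pos|].
    assert (Hn' : 0 <= INR n <= INR N) by (split; [apply pos_INR|apply le_INR; lia]).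
    assert (Ha' : 0 <= INR a <= INR q) by (split; [apply pos_INR|apply le_INR; lia]).
    assert (Hb' : 0 <= INR b <= INR q) by (split; [apply pos_INR|apply le_INR; lia]).
    assert (Hs' : 0 <= s' <= s).
    { unfold s', s. split.
      - assert (0 <= INR a * IZR h1) by (apply Rmult_le_pos; lra).
        assert (0 <= INR b * IZR h2) by (apply Rmult_le_pos; lra). lra.
      - apply Rplus_le_compat; apply Rmult_le_compat_r; lra. }
    assert (Hy : Rabs (IZR (y n a b) - beta * IZR (x n a b)) <= 1 + rho).
    { rewrite Ex, Ey.
      replace (_ - _) with (- (beta * INR n - IZR (Zfloor (beta * INR n)))
         + - (INR a * (IZR h1 * beta - IZR p1) + INR b * (IZR h2 * beta - IZR p2))) by (unfold s'; ring).
      eapply Rle_trans; [apply Rabs_triang|]. rewrite !Rabs_Ropp. apply Rplus_le_compat.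
      - assert (F := Zfloor_bound (beta * INR n)). apply Rabs_le; lra.
      - eapply Rle_trans; [apply Rabs_triang|]. eapply Rle_trans; [|exact Hr].
        rewrite !Rabs_mult, (Rabs_pos_eq (INR a)), (Rabs_pos_eq (INR b)) by lra.
        apply Rplus_le_compat; apply Rmult_le_compat_r; auto using Rabs_pos; lra. }
    (* That is, x y - beta n^2 = x (y - beta x) + beta (x^2 - n^2): the distance of (x, y) from the
       line y = beta x, plus the effect of the shift in x. *)
    replace (_ - _) with (IZR (x n a b) * (IZR (y n a b) - beta * IZR (x n a b))
       + beta * s' * (2 * INR n + s')) by (rewrite Ex; ring).
    eapply Rle_trans; [apply Rabs_triang|]. unfold V. apply Rplus_le_compat.
    - rewrite Rabs_mult. apply Rmult_le_compat; auto using Rabs_pos.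
      rewrite Ex, Rabs_pos_eq; lra.
    - rewrite !Rabs_mult, (Rabs_pos_eq s'), (Rabs_pos_eq (2 * _ + _)) by lra.
      apply Rmult_le_compat; [|lra| |lra].
      + apply Rmult_le_pos; [apply Rabs_pos|lra].
      + apply Rmult_le_compat_l; [apply Rabs_pos|lra]. }
  set (W := Csum (seq 0 q) (fun a => Csum (seq 0 q) (fun b => Csum (seq 1 N) (fun n => U n a b)))).
  assert (EW : W = (INR q * T)%C).
  { unfold W. rewrite (Csum_ext _ _ (fun a => Csum (seq 1 N) (fun n => Csum (seq 0 q) (fun b => U n a b))))
      by (intros; apply Csum_exchange).
    rewrite Csum_exchange. unfold T. rewrite <- Csum_scal. apply Csum_ext. intros n _.
    unfold U.
    rewrite (Csum_ext _ _ (fun a => (e (- (beta * t) * INR n ^ 2) * Csum (seq 0 q) (fun b =>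
       e (- (IZR c / INR q) * (IZR (x n a b) * IZR (y n a b)))))%C)).
    2:{ intros a _. rewrite <- Csum_scal. apply Csum_ext; intros b _. ring. }
    rewrite Csum_scal. unfold x, y. rewrite complete_box_sum by assumption. ring. }
  assert (E : Cmod (INR q * INR q * S - W) <= INR q * (INR q * (2 * s + 2 * bad_count beta rho N + INR N * (8 * Rabs t * V)))).
  { replace (INR q * INR q * S)%C with (Csum (seq 0 q) (fun a => Csum (seq 0 q) (fun b => S))).
    2:{ rewrite !Csum_const, !length_seq. ring. }
    unfold W. rewrite <- Csum_minus.
    replace (INR q) with (INR (length (seq 0 q))) at 1 by now rewrite length_seq.
    apply Cmod_Csum_le_const. intros a Ha.
    rewrite <- Csum_minus.
    replace (INR q) with (INR (length (seq 0 q))) at 1 by now rewrite length_seq.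
    apply Cmod_Csum_le_const. intros b Hb.
    set (B := Csum (seq 1 N) (fun n => box_term theta beta h1 p1 h2 p2 n a b)).
    replace (S - _)%C with ((S - B) + (B - Csum (seq 1 N) (fun n => U n a b)))%C by ring.
    eapply Rle_trans; [apply Cmod_triangle|]. apply Rplus_le_compat.
    - apply in_seq in Ha, Hb. apply box_shift; auto; lia.
    - unfold B. rewrite <- Csum_minus.
      replace (INR N) with (INR (length (seq 1 N))) by now rewrite length_seq.
      apply Cmod_Csum_le_const. intros n Hn. apply C1; assumption. }
  rewrite EW in E.
  replace (INR q * INR q * S - INR q * T)%C with (INR q * (INR q * S - T))%C in E by ring.
  rewrite Cmod_mult, Cmod_R, Rabs_pos_eq in E by lra.
  apply Rmult_le_reg_l in E; assumption.
Qed.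

(** The mean is divided by N and the integral by X. The discrepancy 1 - N / X <= 1 / X meets an
    integral of size at most X, which costs 1; the other unit in the constant 2 comes from the
    Riemann sum. *)
Lemma major_arc_mean (X beta t Err : R) (q N : nat) (S : C) :
  (0 < q)%nat -> (0 < N)%nat -> INR N <= X <= INR N + 1 ->
  Cmod (INR q * S - Csum (seq 1 N) (fun n => e (- (beta * t) * INR n ^ 2))) <= INR q * Err ->
  Cmod (RtoC (/ INR N) * S
     - RtoC (/ (INR q * X)) * CInt (fun v => e (- beta * v ^ 2 * t)) 0 X)
  <= (Err + 16 * (Rabs beta * Rabs t) * INR N ^ 2 + 2) / INR N.
Proof.
  intros Hq HN HX H.
  assert (Q1 : 1 <= INR q) by (apply (le_INR 1); lia).
  assert (N1 : 1 <= INR N) by (apply (le_INR 1); lia).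
  set (T := Csum (seq 1 N) _) in *.
  replace (CInt (fun v => e (- beta * v ^ 2 * t)) 0 X) with (CInt (fun v => e (- (beta * t) * v ^ 2)) 0 X).
  2:{ apply (RInt_ext (V := C_R_CompleteNormedModule)). intros v _. f_equal. ring. }
  assert (R1 := Riemann_sum_e_quadratic (- (beta * t)) X N HX). fold T in R1.
  rewrite Rabs_Ropp, Rabs_mult in R1.
  assert (R2 : Cmod (CInt (fun v => e (- (beta * t) * v ^ 2)) 0 X) <= X).
  { assert (B := Cmod_CInt_le (- (beta * t)) 0 X 1 0 ltac:(lra)).
    assert (B' : Cmod (RtoC (X - 0) * 0 - CInt (fun v => e (- (beta * t) * v ^ 2)) 0 X) <= (X - 0) * 1).
    { apply B. intros v _. replace (0 - e (- (beta * t) * v ^ 2))%C with (- e (- (beta * t) * v ^ 2))%C by ring.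
      rewrite Cmod_opp, Cmod_e. lra. }
    replace (_ - _)%C with (- CInt (fun v => e (- (beta * t) * v ^ 2)) 0 X)%C in B' by ring.
    rewrite Cmod_opp in B'. lra. }
  set (I := CInt _ 0 X) in *.
  set (kq := RtoC (/ INR q)). set (kN := RtoC (/ INR N)).
  assert (Ekq : (kq * INR q)%C = 1).
  { unfold kq. rewrite <- RtoC_mult, Rinv_l by lra. reflexivity. }
  assert (Mq : Cmod kq <= 1).
  { unfold kq. rewrite Cmod_R, Rabs_pos_eq by (left; apply Rinv_0_lt_compat; lra).
    rewrite <- Rinv_1. apply Rinv_le_contravar; lra. }
  assert (MN : Cmod kN = / INR N).
  { unfold kN. rewrite Cmod_R, Rabs_pos_eq by (left; apply Rinv_0_lt_compat; lra). reflexivity. }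
  assert (Mx : Cmod (RtoC (1 - INR N / X)) <= / X).
  { rewrite Cmod_R. replace (1 - INR N / X) with ((X - INR N) * / X) by (field; lra).
    assert (0 < / X) by (apply Rinv_0_lt_compat; lra).
    rewrite Rabs_mult, (Rabs_pos_eq (X - INR N)), (Rabs_pos_eq (/ X)) by lra. nra. }
  assert (Ex : (RtoC (/ (INR q * X)) = kN * kq * (1 - RtoC (1 - INR N / X)))%C).
  { unfold kN, kq. rewrite <- RtoC_minus, <- !RtoC_mult. f_equal. field. lra. }
  rewrite Ex.
  replace (kN * S - kN * kq * (1 - RtoC (1 - INR N / X)) * I)%C with
    (kN * (kq * (INR q * S - T) + kq * (T - I) + kq * (RtoC (1 - INR N / X) * I)))%C.
  2:{ transitivity (kN * ((kq * INR q) * S - kq * (1 - RtoC (1 - INR N / X)) * I))%C; [ring|].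
      rewrite Ekq. ring. }
  rewrite Cmod_mult, MN. unfold Rdiv. rewrite Rmult_comm.
  apply Rmult_le_compat_r; [left; apply Rinv_0_lt_compat; lra|].
  eapply Rle_trans; [apply Cmod_triangle|].
  eapply Rle_trans; [apply Rplus_le_compat_r, Cmod_triangle|].
  rewrite !Cmod_mult.
  assert (E1 : Cmod kq * Cmod (INR q * S - T) <= Err).
  { apply Rle_trans with (Cmod kq * (INR q * Err)); [apply Rmult_le_compat_l; [apply Cmod_ge_0|exact H]|].
    right. rewrite <- Rmult_assoc. replace (Cmod kq * INR q) with 1; [ring|].
    unfold kq. rewrite Cmod_R, Rabs_pos_eq by (left; apply Rinv_0_lt_compat; lra). rewrite Rinv_l; lra. }
  assert (E2 : Cmod kq * Cmod (T - I) <= 16 * (Rabs beta * Rabs t) * INR N ^ 2 + 1).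
  { assert (P := Cmod_ge_0 (T - I)). nra. }
  assert (E3 : Cmod kq * (Cmod (RtoC (1 - INR N / X)) * Cmod I) <= 1).
  { assert (P := Cmod_ge_0 I). assert (P' := Cmod_ge_0 (RtoC (1 - INR N / X))).
    assert (F : Cmod (RtoC (1 - INR N / X)) * Cmod I <= / X * X) by (apply Rmult_le_compat; lra).
    rewrite Rinv_l in F by lra.
    assert (P2 := Cmod_ge_0 kq).
    apply Rle_trans with (1 * 1); [|lra]. apply Rmult_le_compat; try lra. apply Rmult_le_pos; lra. }
  lra.
Qed.

(** * Large X *)

Lemma Rpower_ge_eventually (c s : R) : 0 < s ->
  exists Y0, 1 <= Y0 /\ forall Y, Y0 <= Y -> c <= Rpower Y s.
Proof.
  intros Hs. set (c' := Rmax c 1).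
  assert (Hc : 1 <= c') by apply Rmax_r. assert (Hc' : c <= c') by apply Rmax_l.
  assert (H1 : 1 <= Rpower c' (/ s)).
  { rewrite <- (Rpower_O c') by lra. apply Rle_Rpower; [assumption|].
    left; apply Rinv_0_lt_compat; assumption. }
  exists (Rpower c' (/ s)). split; [assumption|].
  intros Y HY. apply Rle_trans with (Rpower (Rpower c' (/ s)) s).
  - rewrite Rpower_mult, Rinv_l, Rpower_1; lra.
  - apply Rle_Rpower_l; lra.
Qed.

Lemma Rpower_pos x y : 0 < Rpower x y.
Proof. apply exp_pos. Qed.

Lemma Rpower_pow_mult (Y s : R) (n : nat) : Rpower Y s ^ n = Rpower Y (s * INR n).
Proof. rewrite <- Rpower_mult, Rpower_pow; [reflexivity|apply Rpower_pos]. Qed.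

Lemma sum_n_m_Csum (f : nat -> C) (N : nat) : sum_n_m f 1 N = Csum (seq 1 N) f.
Proof.
  induction N as [|N IH].
  - rewrite sum_n_m_zero by lia. reflexivity.
  - rewrite sum_n_Sm by lia. rewrite IH, Csum_seq_S. reflexivity.
Qed.

(** Some admissible exponent lies below 2 mu because 2 mu > mu. Irrationality excludes equality, so
    the absence of solutions becomes a lower bound for every fraction. *)
Lemma irrational_diophantine (b mu : R) :
  irrational b -> 1 <= mu -> Rbar_le (irrationality_exponent b) (Finite mu) ->
  exists m, 0 < m /\ forall p q : Z, (1 <= q)%Z ->
    m * Rpower (IZR q) (- (2 * mu)) <= Rabs (IZR q * b - IZR p).
Proof.
  intros Hb Hmu Hexp.
  assert (HM : exists M, admissible_exponent b M /\ M <= 2 * mu).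
  { apply NNPP. intros Hn.
    destruct (Glb_Rbar_correct (admissible_exponent b)) as [_ G].
    assert (L : Rbar_le (Finite (2 * mu)) (irrationality_exponent b)).
    { apply G. intros M HM. simpl. destruct (Rle_lt_dec (2 * mu) M); [assumption|].
      exfalso; apply Hn. exists M; split; [assumption|lra]. }
    assert (L' := Rbar_le_trans _ _ _ L Hexp). simpl in L'. lra. }
  destruct HM as [M [[M1 [m [Hm HN]]] M2]].
  exists m. split; [assumption|]. intros p q Hq.
  assert (Hq' := IZR_le _ _ Hq).
  assert (P : 0 < Rabs (b - IZR p / IZR q)).
  { apply Rabs_pos_lt. intros E. apply Hb. exists p, q. split; [lia|lra]. }
  assert (L : m / Rpower (IZR q) M <= Rabs (b - IZR p / IZR q)).
  { apply Rnot_lt_le. intros L. apply HN. exists p, q. auto. }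
  replace (IZR q * b - IZR p) with (IZR q * (b - IZR p / IZR q)) by (field; lra).
  rewrite Rabs_mult, (Rabs_pos_eq (IZR q)) by lra.
  apply Rle_trans with (1 * Rabs (b - IZR p / IZR q)); [|apply Rmult_le_compat_r; lra].
  rewrite Rmult_1_l. eapply Rle_trans; [|exact L].
  unfold Rdiv. rewrite <- Rpower_Ropp. apply Rmult_le_compat_l; [lra|].
  apply Rle_Rpower; lra.
Qed.

(** With X = Y^mu, the relation r1 r2 X <= 2 reduces the bound on r2 to r1 X >= Y^(1/4). The bound
    on [bad_count] comes from the approximation p1 / h1, whose denominator is at least Y^(1/5). *)
Lemma diophantine_basis (beta mu : R) :
  irrational beta -> 1 <= mu -> Rbar_le (irrationality_exponent beta) (Finite mu) ->
  exists Y0, 1 <= Y0 /\ forall Y, Y0 <= Y ->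
  exists (h1 p1 h2 p2 : Z) (r1 r2 : R),
    ((h1 * p2 - h2 * p1) ^ 2 = 1)%Z /\ 0 < r1 /\ r1 <= r2 /\ r2 <= 2 * Rpower Y (- / 4) /\
    r1 * r2 * Rpower Y mu <= 2 /\
    0 <= IZR h1 <= r1 * Rpower Y mu /\ 0 <= IZR h2 <= r2 * Rpower Y mu /\
    Rabs (IZR h1 * beta - IZR p1) <= r1 /\ Rabs (IZR h2 * beta - IZR p2) <= r2 /\
    forall (N : nat) (rho : R), Rpower Y mu <= 2 * INR N -> 0 <= rho ->
      bad_count beta rho N <= (4 * rho + 4 * Rpower Y (- / 5)) * INR N.
Proof.
  intros Hb Hmu Hexp.
  destruct (irrational_diophantine beta mu Hb Hmu Hexp) as [m [Hm Dio]].
  destruct (Rpower_ge_eventually (/ m) (/ 4) ltac:(lra)) as [Y1 [Y1g HY1]].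
  destruct (Rpower_ge_eventually (3 * / m ^ 2) (/ 5) ltac:(lra)) as [Y2 [Y2g HY2]].
  destruct (Rpower_ge_eventually 8 (4 / 5) ltac:(lra)) as [Y3 [Y3g HY3]].
  exists (Rmax Y1 (Rmax Y2 Y3)). split; [apply Rle_trans with Y1; [lra|apply Rmax_l]|].
  intros Y HY.
  assert (G1 : / m <= Rpower Y (/ 4)) by (apply HY1; eapply Rle_trans; [apply Rmax_l|exact HY]).
  assert (G2 : 3 * / m ^ 2 <= Rpower Y (/ 5)).
  { apply HY2. eapply Rle_trans; [|exact HY]. eapply Rle_trans; [apply Rmax_l|apply Rmax_r]. }
  assert (G3 : 8 <= Rpower Y (4 / 5)).
  { apply HY3. eapply Rle_trans; [|exact HY]. eapply Rle_trans; [apply Rmax_r|apply Rmax_r]. }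
  assert (HY0 : 1 <= Y) by (eapply Rle_trans; [exact Y1g|]; eapply Rle_trans; [apply Rmax_l|exact HY]).
  clear HY HY1 HY2 HY3.
  set (X := Rpower Y mu).
  assert (HX8 : 8 <= X) by (eapply Rle_trans; [exact G3|apply Rle_Rpower; lra]).
  destruct (reduced_basis beta X ltac:(lra)) as (h1 & p1 & h2 & p2 & r1 & r2 & A1 & A2 & D & R1 & R2 & R3 & E1 & E2).
  destruct (lattice_form_bounds beta X h1 p1 r1 ltac:(lra) R1 A1 E1) as (B1 & B2 & B3).
  destruct (lattice_form_bounds beta X h2 p2 r2 ltac:(lra) ltac:(lra) A2 E2) as (C1 & C2 & _).
  (* A small h1 forces r1 to be large: either h1 = 0 and |p1| >= 1, or the Diophantine bound applies
     to p1 / h1. *)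
  assert (Low : forall s, 0 < s -> IZR h1 < Rpower Y s -> r1 >= 1 \/ m * Rpower Y (- (2 * mu * s)) <= r1).
  { intros s Hs Hh. destruct (Z.eq_dec h1 0) as [E|Nh].
    - left. assert (N : p1 <> 0%Z) by (intros ->; rewrite E in D; rewrite Z.mul_0_r in D; discriminate).
      apply Rle_ge. eapply Rle_trans; [|exact B2]. rewrite E, Rmult_0_l, Rminus_0_l, Rabs_Ropp, <- abs_IZR.
      apply IZR_le; lia.
    - right. eapply Rle_trans; [|exact B2]. eapply Rle_trans; [|apply Dio; lia].
      apply Rmult_le_compat_l; [lra|].
      replace (- (2 * mu * s)) with (s * - (2 * mu)) by ring. rewrite <- Rpower_mult, !Rpower_Ropp.
      assert (1 <= IZR h1) by (apply IZR_le; lia).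
      apply Rinv_le_contravar; [apply Rpower_pos|]. apply Rle_Rpower_l; lra. }
  (* Either h1 <= r1 X is already large, or r1 X >= m Y^(mu/2), and m Y^(1/4) >= 1 gives the
     claim. *)
  assert (RX : Rpower Y (/ 4) <= r1 * X).
  { destruct (Rle_lt_dec (Rpower Y (/ 4)) (IZR h1)) as [L|L]; [lra|].
    destruct (Low (/ 4) ltac:(lra) L) as [H|H].
    - apply Rle_trans with X; [apply Rle_Rpower; lra|nra].
    - apply Rle_trans with (m * Rpower Y (- (2 * mu * / 4)) * X); [|apply Rmult_le_compat_r; lra].
      unfold X. rewrite Rmult_assoc, <- Rpower_plus.
      apply Rle_trans with (m * (Rpower Y (/ 4) * Rpower Y (/ 4))).
      + assert (1 <= m * Rpower Y (/ 4)).
        { apply Rmult_le_compat_l with (r := m) in G1; [|lra]. rewrite Rinv_r in G1; lra. }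
        assert (P := Rpower_pos Y (/ 4)). nra.
      + rewrite <- Rpower_plus. apply Rmult_le_compat_l; [lra|]. apply Rle_Rpower; lra. }
  (* Otherwise r1^2 X >= m^2 Y^(mu - 4 mu / 5) >= 3, against r1^2 X <= 2. This is why the exponent
     here has to be below 1/4. *)
  assert (Hh1 : Rpower Y (/ 5) <= IZR h1).
  { apply Rnot_lt_le. intros L.
    assert (S : r1 ^ 2 * X <= 2) by nra.
    destruct (Low (/ 5) ltac:(lra) L) as [H|H]; [nra|].
    assert (S' : (m * Rpower Y (- (2 * mu * / 5))) ^ 2 * X <= 2).
    { eapply Rle_trans; [|exact S]. apply Rmult_le_compat_r; [lra|]. apply pow_incr. split; [|exact H].
      apply Rmult_le_pos; [lra|left; apply Rpower_pos]. }
    rewrite Rpow_mult_distr, Rpower_pow_mult in S'. unfold X in S'.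
    rewrite Rmult_assoc, <- Rpower_plus in S'.
    assert (Rpower Y (/ 5) <= Rpower Y (- (2 * mu * / 5) * INR 2 + mu)) by (apply Rle_Rpower; simpl; lra).
    assert (m2 : 0 < m ^ 2) by (apply pow_lt; lra).
    assert (m ^ 2 * (3 * / m ^ 2) = 3) by (field; lra). nra. }
  exists h1, p1, h2, p2, r1, r2. fold X.
  split; [exact D|]. split; [exact R1|]. split; [exact R2|].
  split.
  { apply Rmult_le_reg_r with (Rpower Y (/ 4)); [apply Rpower_pos|].
    rewrite Rmult_assoc, <- Rpower_plus. replace (- / 4 + / 4) with 0 by ring.
    rewrite Rpower_O by lra. nra. }
  do 5 (split; [assumption|]).
  intros N rho HN Hrho.
  assert (H51 : 1 <= Rpower Y (/ 5)) by (rewrite <- (Rpower_O Y) by lra; apply Rle_Rpower; lra).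
  assert (Hh1' : (1 <= h1)%Z) by (apply le_IZR; lra).
  assert (Hg : Z.gcd p1 h1 = 1%Z).
  { apply Z.bezout_1_gcd. destruct (Z.eq_dec (h1 * p2 - h2 * p1) 1) as [d|d].
    + exists (- h2)%Z, p2. lia.
    + exists h2, (- p2)%Z. nia. }
  assert (P5 := Rpower_pos Y (- / 5)).
  assert (E5 : Rpower Y (- / 5) * Rpower Y (/ 5) = 1).
  { rewrite <- Rpower_plus, Rplus_opp_l. apply Rpower_O; lra. }
  eapply Rle_trans; [apply (bad_count_le beta rho h1 p1 N); try assumption|].
  - assert (r1 ^ 2 * X <= 2) by nra. lra.
  - assert (J : INR N / IZR h1 <= Rpower Y (- / 5) * INR N).
    { apply Rmult_le_reg_r with (IZR h1); [lra|].
      replace (INR N / IZR h1 * IZR h1) with (INR N) by (field; lra).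
      assert (INR N * 1 <= INR N * (Rpower Y (- / 5) * IZR h1)); [|lra].
      apply Rmult_le_compat_l; [apply pos_INR|]. rewrite <- E5. apply Rmult_le_compat_l; lra. }
    assert (J2 : IZR h1 <= INR N).
    { assert (r1 ^ 2 * X <= 2) by nra. assert (IZR h1 ^ 2 <= 2 * X) by nra. nra. }
    assert (J3 : 3 <= Rpower Y (- / 5) * INR N).
    { assert (Rpower Y (4 / 5) = Rpower Y (- / 5) * Rpower Y 1) by (rewrite <- Rpower_plus; f_equal; lra).
      assert (Rpower Y 1 <= X) by (apply Rle_Rpower; lra). nra. }
    replace ((INR N / IZR h1 + 1) * (2 * rho * IZR h1 + 3))
      with (2 * rho * INR N + 3 * (INR N / IZR h1) + 2 * (rho * IZR h1) + 3) by (field; lra).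
    assert (rho * IZR h1 <= rho * INR N) by (apply Rmult_le_compat_l; lra).
    lra.
Qed.

Lemma exp_mean_Csum (theta beta X : R) :
  exp_mean theta beta X =
  (RtoC (/ INR (Z.to_nat (Zfloor X)))
   * Csum (seq 1 (Z.to_nat (Zfloor X))) (fun n => e (- theta * INR n * IZR (Zfloor (beta * INR n)))))%C.
Proof. unfold exp_mean, mean. rewrite sum_n_m_Csum. reflexivity. Qed.

Lemma floor_nat_bounds X : 1 <= X ->
  let N := Z.to_nat (Zfloor X) in (0 < N)%nat /\ INR N <= X <= INR N + 1 /\ X <= 2 * INR N.
Proof.
  intros HX N. assert (B := Zfloor_bound X).
  assert (1 <= Zfloor X)%Z by (apply Zfloor_lub; lra).
  assert (E : INR N = IZR (Zfloor X)) by (unfold N; rewrite INR_IZR_INZ, Z2Nat.id by lia; reflexivity).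
  assert (1 <= IZR (Zfloor X)) by (apply IZR_le; assumption).
  split; [unfold N; lia|]. rewrite E; lra.
Qed.

(** This is [major_arc_of_large_sum] with g = Y^(-k/2), which is delta_1^(1/2). Its numerical
    hypotheses hold for large Y because k <= 1/1000 leaves a positive power of Y to spare in
    each. *)
Lemma minor_arc_bound (beta mu k : R) :
  irrational beta -> irrational (beta ^ 2) -> 1 <= mu ->
  Rbar_le (irrationality_exponent beta) (Finite mu) ->
  Rbar_le (irrationality_exponent (beta ^ 2)) (Finite mu) ->
  0 < k <= / 1000 ->
  exists Y0, 1 <= Y0 /\ forall Y theta, Y0 <= Y ->
    Cmod (exp_mean theta beta (Rpower Y mu)) <= Rpower Y (- (k / 2)) \/
    exists a q : Z, (1 <= q)%Z /\ IZR q <= 2 * Rpower Y (9 * k / 2) /\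
      Rabs (theta - IZR a / IZR q) <= Rpower Y (9 * k) / Rpower Y mu ^ 2.
Proof.
  intros Hb Hb2 Hmu Hexp Hexp2 Hk.
  destruct (diophantine_basis beta mu Hb Hmu Hexp) as (Y1 & G1 & HY1).
  destruct (irrational_diophantine (beta ^ 2) mu Hb2 Hmu Hexp2) as (m & Hm & Dio).
  assert (Hbeta : beta <> 0) by (intros ->; apply Hb; exists 0%Z, 1%Z; split; [lia|field]).
  assert (Hbeta' : 0 < Rabs beta) by (apply Rabs_pos_lt; assumption).
  set (c := 16 * (2 * Rabs beta + 1)).
  destruct (Rpower_ge_eventually 64 (k / 2) ltac:(lra)) as (Y2 & G2 & HY2).
  destruct (Rpower_ge_eventually (2 ^ 19) (/ 10) ltac:(lra)) as (Y3 & G3 & HY3).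
  destruct (Rpower_ge_eventually (16 / Rabs beta) (k / 2) ltac:(lra)) as (Y4 & G4 & HY4).
  destruct (Rpower_ge_eventually (c + 1) (/ 10) ltac:(lra)) as (Y5 & G5 & HY5).
  destruct (Rpower_ge_eventually (/ m * c + 1) (/ 10) ltac:(lra)) as (Y6 & G6 & HY6).
  destruct (Rpower_ge_eventually 16 (/ 1000) ltac:(lra)) as (Y7 & G7 & HY7).
  exists (Y1 + Y2 + Y3 + Y4 + Y5 + Y6 + Y7). split; [lra|]. intros Y theta HY.
  specialize (HY1 Y ltac:(lra)). specialize (HY2 Y ltac:(lra)). specialize (HY3 Y ltac:(lra)).
  specialize (HY4 Y ltac:(lra)). specialize (HY5 Y ltac:(lra)). specialize (HY6 Y ltac:(lra)).
  specialize (HY7 Y ltac:(lra)).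
  assert (HY0 : 1 <= Y) by lra.
  assert (Pp := Rpower_pos Y).
  assert (Pm : forall s t, s <= t -> Rpower Y s <= Rpower Y t) by (intros; apply Rle_Rpower; lra).
  assert (Pinv : forall s, Rpower Y (- s) * Rpower Y s = 1).
  { intros s. rewrite <- Rpower_plus, Rplus_opp_l. apply Rpower_O; lra. }
  set (X := Rpower Y mu) in *.
  assert (HX : 1 <= X) by (unfold X; rewrite <- (Rpower_O Y) by lra; apply Pm; lra).
  destruct (floor_nat_bounds X HX) as (N0 & NX & NX2). set (N := Z.to_nat (Zfloor X)) in *.
  assert (Npos : 0 < INR N) by (apply lt_0_INR; assumption).
  destruct (Rle_lt_dec (Cmod (exp_mean theta beta X)) (Rpower Y (- (k / 2)))) as [L|L]; [left; exact L|right].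
  rewrite exp_mean_Csum in L. fold N in L.
  rewrite Cmod_mult, Cmod_R, Rabs_pos_eq in L by (left; apply Rinv_0_lt_compat; assumption).
  set (g := Rpower Y (- (k / 2))) in *.
  assert (Hg : / g = Rpower Y (k / 2)) by (unfold g; rewrite Rpower_Ropp, Rinv_inv; reflexivity).
  assert (g0 : 0 < g) by apply Pp.
  assert (d17 : (/ g) ^ 17 = Rpower Y (17 * k / 2)).
  { rewrite Hg, Rpower_pow_mult. f_equal. simpl; field. }
  destruct HY1 as (h1 & p1 & h2 & p2 & r1 & r2 & D & R1 & R12 & R2 & RX & A1 & A2 & T1 & T2 & Bad).
  assert (S1 : 16 * (/ g) ^ 17 * (2 * Rabs beta + 1) / X <= c * Rpower Y (17 * k / 2 - mu)).
  { unfold X. rewrite d17. unfold Rminus. rewrite Rpower_plus, Rpower_Ropp. unfold c. right; field.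
    apply Rgt_not_eq, Pp. }
  destruct (major_arc_of_large_sum theta beta X g h1 p1 h2 p2 r1 r2 N) as (a & q & Hq & Q & T); try assumption.
  - rewrite <- (Rinv_inv g), Hg. apply Rinv_le_contravar; lra.
  - intros rho Hrho. eapply Rle_trans; [apply Bad; assumption|]. apply Rmult_le_compat_r; [lra|].
    apply Rplus_le_compat_l.
    assert (64 * Rpower Y (- / 5) <= g); [|lra].
    unfold g. replace (- (k / 2)) with (- / 5 + (/ 5 - k / 2)) by ring. rewrite Rpower_plus.
    rewrite Rmult_comm. apply Rmult_le_compat_l; [left; apply Pp|].
    apply Rle_trans with (Rpower Y (/ 10)); [lra|apply Pm; lra].
  - eapply Rle_trans; [exact R2|]. unfold g. rewrite Rpower_pow_mult.
    replace (- (k / 2) * INR 5) with (- / 4 + (/ 4 - 5 * k / 2)) by (simpl; field). rewrite Rpower_plus.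
    unfold Rdiv. rewrite Rmult_assoc, (Rmult_comm 2). apply Rmult_le_compat_l; [left; apply Pp|].
    apply Rmult_le_reg_r with (2 ^ 18); [lra|].
    rewrite Rmult_assoc, Rinv_l, Rmult_1_r by lra.
    apply Rle_trans with (Rpower Y (/ 10)); [lra|apply Pm; lra].
  - intros u w Nw Hw. eapply Rle_lt_trans; [exact S1|].
    assert (Dw : m * Rpower (Rabs (IZR w)) (- (2 * mu)) <= Rabs (IZR u - IZR w * beta ^ 2)).
    { rewrite Rabs_minus_sym. destruct (Z_lt_le_dec 0 w).
      - rewrite Rabs_pos_eq by (apply IZR_le; lia). apply Dio; lia.
      - assert (IZR w < 0) by (apply IZR_lt; lia). rewrite (Rabs_left (IZR w)) by assumption.
        rewrite <- opp_IZR. eapply Rle_trans; [apply (Dio (- u)%Z (- w)%Z); lia|].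
        rewrite <- Rabs_Ropp, !opp_IZR. right; f_equal; ring. }
    eapply Rlt_le_trans; [|exact Dw].
    assert (W1 : 1 <= Rabs (IZR w)) by (rewrite <- abs_IZR; apply IZR_le; lia).
    assert (W2 : Rabs (IZR w) <= Rpower Y (/ 1000 + 17 * k / 2)).
    { rewrite Rpower_plus. eapply Rle_trans; [exact Hw|]. rewrite d17. apply Rmult_le_compat_r; [left; apply Pp|exact HY7]. }
    apply Rlt_le_trans with (m * Rpower Y ((/ 1000 + 17 * k / 2) * - (2 * mu))).
    + replace ((/ 1000 + 17 * k / 2) * - (2 * mu)) with ((17 * k / 2 - mu) + ((/ 1000 + 17 * k / 2) * - (2 * mu) + mu - 17 * k / 2)) by ring.
      rewrite (Rpower_plus (17 * k / 2 - mu)).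
      (* The lower bound m |w|^(-2 mu) has exponent close to 0 relative to mu, the upper bound has
         exponent near -mu. As mu >= 1, a factor Y^(1/10) is available to absorb c and m. *)
      assert (/ 10 <= (/ 1000 + 17 * k / 2) * - (2 * mu) + mu - 17 * k / 2) by nra.
      apply Pm in H. set (z := Rpower Y (_ + mu - _)) in *.
      assert (c < m * z).
      { apply Rlt_le_trans with (m * (/ m * c + 1)); [|apply Rmult_le_compat_l; lra].
        replace (m * (/ m * c + 1)) with (c + m) by (field; lra). lra. }
      assert (P := Pp (17 * k / 2 - mu)). nra.
    + apply Rmult_le_compat_l; [lra|]. rewrite <- Rpower_mult, !(Rpower_Ropp _ (2 * mu)).
      apply Rinv_le_contravar; [apply Rpower_pos|]. apply Rle_Rpower_l; lra.
  - eapply Rle_lt_trans; [exact S1|].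
    apply Rle_lt_trans with (c * Rpower Y (- / 10)).
    + apply Rmult_le_compat_l; [unfold c; lra|]. apply Pm. lra.
    + assert (P := Pinv (/ 10)). assert (P' := Pp (- / 10)). nra.
  - apply Rmult_lt_compat_r with (r := INR N) in L; [|assumption].
    rewrite Rmult_assoc, (Rmult_comm (Cmod _)), <- Rmult_assoc, Rinv_l, Rmult_1_l in L by lra. exact L.
  - exists a, q. split; [assumption|]. split.
    + replace (Rpower Y (9 * k / 2)) with ((/ g) ^ 9); [exact Q|].
      rewrite Hg, Rpower_pow_mult. f_equal. simpl; field.
    + eapply Rle_trans; [exact T|]. rewrite d17. unfold Rdiv. apply Rmult_le_compat_r.
      { left; apply Rinv_0_lt_compat, pow_lt; lra. }
      (* The spare Y^(k/2) absorbs 16 / |beta|. *)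
      replace (9 * k) with (k / 2 + 17 * k * / 2) by field. rewrite Rpower_plus.
      rewrite Rmult_assoc, (Rmult_comm (Rpower Y _) (/ _)), <- Rmult_assoc.
      apply Rmult_le_compat_r; [left; apply Pp|exact HY4].
Qed.

(** Every error is at most a constant depending on beta times z = Y^(-1/5), times K = Y^(12 k2)
    where |t| enters. The shifts of a q by q box stay harmless because q is at most 12 Y^(12 k1). *)
Lemma major_arc_asymptotic (beta mu k1 k2 k3 : R) :
  irrational beta -> 1 <= mu -> Rbar_le (irrationality_exponent beta) (Finite mu) ->
  0 < k1 <= / 1000 -> 0 < k2 -> 0 < k3 <= / 10 ->
  exists Y0, 1 <= Y0 /\ forall Y theta (a q : Z) t, Y0 <= Y ->
    (1 <= q)%Z -> IZR q <= 12 * Rpower Y (12 * k1) -> theta = IZR a / IZR q + t ->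
    Rabs t <= 12 * Rpower Y (12 * k2) / Rpower Y mu ^ 2 -> Z.gcd a q = 1%Z ->
    Cmod (exp_mean theta beta (Rpower Y mu)
       - RtoC (/ (IZR q * Rpower Y mu)) * CInt (fun v => e (- beta * v ^ 2 * t)) 0 (Rpower Y mu))%C
    <= 12 * Rpower Y (12 * k2) * Rpower Y (- (k3 / 2)).
Proof.
  intros Hb Hmu Hexp Hk1 Hk2 Hk3.
  destruct (diophantine_basis beta mu Hb Hmu Hexp) as (Y1 & G1 & HY1).
  set (c := 1000 * (1 + 2 * Rabs beta)).
  destruct (Rpower_ge_eventually c (3 / 20) ltac:(lra)) as (Y2 & G2 & HY2).
  destruct (Rpower_ge_eventually 48 (/ 50) ltac:(lra)) as (Y3 & G3 & HY3).
  exists (Y1 + Y2 + Y3). split; [lra|].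
  intros Y theta a q t HY Hq Hq2 Eth Ht Hg.
  specialize (HY1 Y ltac:(lra)). specialize (HY2 Y ltac:(lra)). specialize (HY3 Y ltac:(lra)).
  assert (HY0 : 1 <= Y) by lra.
  assert (Pp := Rpower_pos Y).
  assert (Pm : forall s t, s <= t -> Rpower Y s <= Rpower Y t) by (intros; apply Rle_Rpower; lra).
  set (X := Rpower Y mu) in *.
  assert (HX : 1 <= X) by (unfold X; rewrite <- (Rpower_O Y) by lra; apply Pm; lra).
  destruct (floor_nat_bounds X HX) as (N0 & NX & NX2).
  rewrite exp_mean_Csum. set (N := Z.to_nat (Zfloor X)) in *.
  assert (N1 : 1 <= INR N) by (apply (le_INR 1); lia).
  destruct HY1 as (h1 & p1 & h2 & p2 & r1 & r2 & D & R1 & R12 & R2 & RX & A1 & A2 & T1 & T2 & Bad).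
  set (n := Z.to_nat q).
  assert (En : Z.of_nat n = q) by (unfold n; lia).
  assert (En' : INR n = IZR q) by (rewrite INR_IZR_INZ, En; reflexivity).
  assert (Hn : (0 < n)%nat) by lia.
  assert (Q1 : 1 <= INR n) by (rewrite En'; apply IZR_le; assumption).
  rewrite <- En' in *.
  (* Up to a constant, the error in beta s and the relative length s / X for the q by q box, since
     r1 <= r2 <= 2 Y^(-1/4). *)
  set (eps := INR n * Rpower Y (- / 4)).
  set (z := Rpower Y (- / 5)) in *.
  set (K := Rpower Y (12 * k2)) in *.
  assert (K1 : 1 <= K) by (unfold K; rewrite <- (Rpower_O Y) by lra; apply Pm; lra).
  assert (z0 : 0 < z) by apply Pp.
  assert (e0 : 0 < eps) by (apply Rmult_lt_0_compat; [lra|apply Pp]).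
  assert (ez : 4 * eps <= z).
  { unfold eps. apply Rle_trans with (48 * Rpower Y (12 * k1 + - / 4)).
    - rewrite Rpower_plus. assert (P := Pp (- / 4)). nra.
    - unfold z. replace (- / 5) with (/ 50 + - (11 / 50)) by field. rewrite (Rpower_plus (/ 50)).
      apply Rmult_le_compat; [lra|left; apply Pp|exact HY3|apply Pm; lra]. }
  assert (z1 : z <= 1) by (unfold z; rewrite <- (Rpower_O Y) by lra; apply Pm; lra).
  assert (Hr : forall r, 0 < r -> r <= r2 -> INR n * r <= 2 * eps).
  { intros r Hr0 Hr. unfold eps. assert (INR n * r <= INR n * (2 * Rpower Y (- / 4))) by (apply Rmult_le_compat_l; lra). lra. }
  assert (Q_r1 := Hr r1 R1 R12). assert (Q_r2 := Hr r2 ltac:(lra) ltac:(lra)).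
  set (rho := 4 * eps).
  assert (Hrho : INR n * Rabs (IZR h1 * beta - IZR p1) + INR n * Rabs (IZR h2 * beta - IZR p2) <= rho).
  { assert (INR n * Rabs (IZR h1 * beta - IZR p1) <= INR n * r1) by (apply Rmult_le_compat_l; lra).
    assert (INR n * Rabs (IZR h2 * beta - IZR p2) <= INR n * r2) by (apply Rmult_le_compat_l; lra).
    unfold rho; lra. }
  assert (H1' : (0 <= h1)%Z) by (apply le_IZR; lra). assert (H2' : (0 <= h2)%Z) by (apply le_IZR; lra).
  assert (Ms := major_arc_sum theta beta t rho a h1 p1 h2 p2 n N Hn ltac:(rewrite En; exact Hg) Eth H1' H2' D Hrho).
  cbv zeta in Ms.
  set (s := INR n * IZR h1 + INR n * IZR h2) in *.
  assert (Hs : 0 <= s <= 4 * eps * X).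
  { assert (INR n * IZR h1 <= INR n * (r1 * X)) by (apply Rmult_le_compat_l; lra).
    assert (INR n * IZR h2 <= INR n * (r2 * X)) by (apply Rmult_le_compat_l; lra).
    assert (INR n * r1 * X <= 2 * eps * X) by (apply Rmult_le_compat_r; lra).
    assert (INR n * r2 * X <= 2 * eps * X) by (apply Rmult_le_compat_r; lra).
    assert (0 <= INR n * IZR h1) by (apply Rmult_le_pos; lra).
    assert (0 <= INR n * IZR h2) by (apply Rmult_le_pos; lra).
    unfold s; lra. }
  eapply Rle_trans; [apply (major_arc_mean X beta t _ n N _ Hn N0 NX Ms)|].
  assert (Hbad := Bad N rho NX2 ltac:(unfold rho; lra)).
  set (bc := bad_count beta rho N) in *.
  set (be := Rabs beta) in *. assert (be0 : 0 <= be) by apply Rabs_pos.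
  set (T := Rabs t) in *. assert (T0 : 0 <= T) by apply Rabs_pos.
  assert (TX2 : T * X ^ 2 <= 12 * K).
  { apply Rmult_le_compat_r with (r := X ^ 2) in Ht; [|nra].
    unfold Rdiv in Ht. rewrite Rmult_assoc, Rinv_l, Rmult_1_r in Ht by nra. exact Ht. }
  assert (Xz : 1 <= X * z).
  { unfold X, z. rewrite <- Rpower_plus, <- (Rpower_O Y) by lra. apply Pm; lra. }
  assert (TX : T * X <= 12 * K * z).
  { assert (T * X * 1 <= T * X * (X * z)) by (apply Rmult_le_compat_l; [apply Rmult_le_pos; lra|exact Xz]).
    assert (T * X ^ 2 * z <= 12 * K * z) by (apply Rmult_le_compat_r; lra). lra. }
  assert (V1 : (INR N + s) * (1 + rho) <= 4 * X).
  { apply Rle_trans with ((2 * X) * 2); [|lra].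
    assert (4 * eps * X <= 1 * X) by (apply Rmult_le_compat_r; lra).
    apply Rmult_le_compat; unfold rho; lra. }
  assert (V2 : be * s * (2 * INR N + s) <= be * (z * X) * (3 * X)).
  { assert (4 * eps * X <= z * X) by (apply Rmult_le_compat_r; lra).
    assert (z * X <= 1 * X) by (apply Rmult_le_compat_r; lra).
    apply Rmult_le_compat; [apply Rmult_le_pos; lra|lra|apply Rmult_le_compat_l; lra|lra]. }
  assert (V : 8 * T * ((INR N + s) * (1 + rho) + be * s * (2 * INR N + s)) <= K * z * (384 + 288 * be)).
  { apply Rle_trans with (8 * T * (4 * X + be * (z * X) * (3 * X))).
    - apply Rmult_le_compat_l; lra.
    - replace (8 * T * (4 * X + be * (z * X) * (3 * X))) with (32 * (T * X) + 24 * (be * z) * (T * X ^ 2)) by ring.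
      assert (24 * (be * z) * (T * X ^ 2) <= 24 * (be * z) * (12 * K)).
      { apply Rmult_le_compat_l; [apply Rmult_le_pos; [lra|apply Rmult_le_pos; lra]|lra]. }
      lra. }
  assert (NT : 16 * (be * T) * INR N <= 16 * be * (12 * K * z)).
  { apply Rle_trans with (16 * be * (T * X)); [|apply Rmult_le_compat_l; lra].
    replace (16 * (be * T) * INR N) with (16 * be * (T * INR N)) by ring.
    apply Rmult_le_compat_l; [lra|]. apply Rmult_le_compat_l; lra. }
  assert (zK : z <= K * z) by nra.
  apply Rmult_le_reg_r with (INR N); [lra|].
  unfold Rdiv. rewrite (Rmult_assoc _ (/ INR N)), Rinv_l, Rmult_1_r by lra.
  apply Rle_trans with (K * z * c * INR N).
  - set (v := 8 * T * _) in *.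
    assert (S1 : 2 * s <= 4 * z * INR N).
    { assert (4 * eps * X <= z * X) by (apply Rmult_le_compat_r; lra).
      assert (z * X <= z * (2 * INR N)) by (apply Rmult_le_compat_l; lra). lra. }
    assert (S2 : 2 * bc <= 16 * z * INR N).
    { assert ((4 * rho + 4 * z) * INR N <= 8 * z * INR N) by (apply Rmult_le_compat_r; unfold rho; lra). lra. }
    assert (S3 : INR N * v <= K * z * (384 + 288 * be) * INR N).
    { rewrite Rmult_comm. apply Rmult_le_compat_r; lra. }
    assert (S4 : 16 * (be * T) * INR N ^ 2 <= 16 * be * (12 * K * z) * INR N).
    { replace (INR N ^ 2) with (INR N * INR N) by ring. rewrite <- Rmult_assoc. apply Rmult_le_compat_r; lra. }
    assert (S5 : 2 <= 4 * z * INR N).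
    { assert (z * X <= z * (2 * INR N)) by (apply Rmult_le_compat_l; lra). lra. }
    assert (S6 : z * INR N <= K * z * INR N) by (apply Rmult_le_compat_r; lra).
    assert (0 <= K * z * be * INR N) by (repeat apply Rmult_le_pos; lra).
    unfold c. lra.
  - apply Rmult_le_compat_r; [lra|].
    (* Here c <= Y^(3/20) leaves Y^(-1/20), which is at most delta_3^(1/2) exactly when k3 <= 1/10:
       the origin of the value of [kstar]. *)
    assert (z * c <= Rpower Y (- (k3 / 2))).
    { apply Rle_trans with (Rpower Y (- / 5 + 3 / 20)); [|apply Pm; lra].
      rewrite Rpower_plus. apply Rmult_le_compat_l; [left; apply Pp|exact HY2]. }
    assert (P := Pp (- (k3 / 2))).
    assert (K * (z * c) <= K * Rpower Y (- (k3 / 2))) by (apply Rmult_le_compat_l; lra).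
    assert (0 <= K * Rpower Y (- (k3 / 2))) by (apply Rmult_le_pos; lra). lra.
Qed.

Theorem lemma5p2 :
  exists (K kstar : R) (phi : R -> R),
    1 <= K /\ 0 < kstar /\ (forall x : R, 0 < x -> 0 < phi x) /\
    forall k1 k2 k3 : R,
      0 < k3 <= kstar -> 0 < k2 <= phi k3 -> 0 < k1 <= phi k2 ->
    forall beta mu : R,
      irrational beta -> irrational (beta ^ 2) ->
      non_Liouville beta -> non_Liouville (beta ^ 2) ->
      1 <= mu ->
      Rbar_le (irrationality_exponent beta) (Finite mu) ->
      Rbar_le (irrationality_exponent (beta ^ 2)) (Finite mu) ->
    exists X0 : R,
    forall X theta : R, X0 <= X ->
      let delta1 := Rpower X (- k1 / mu) in
      let delta2 := Rpower X (- k2 / mu) in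
      let delta3 := Rpower X (- k3 / mu) in
      (Cmod (exp_mean theta beta X) <= K * Rpower delta1 (1 / 2) \/
       exists (a q : Z) (t : R), major_arc K delta1 delta2 X theta a q t) /\
      (forall (a q : Z) (t : R),
         major_arc K delta1 delta2 X theta a q t -> Z.gcd a q = 1%Z ->
         Cmod (exp_mean theta beta X
               - RtoC (/ (IZR q * X)) * CInt (fun v => e (- beta * v ^ 2 * t)) 0 X)%C
           <= K * Rpower delta2 (- K) * Rpower delta3 (1 / 2)).
Proof.
  (* The function phi ensures k1 <= 1/1000 and k1 <= k2; the latter turns the bound Y^(9 k1) on |t|
     X^2 into a power of delta_2. The constant 12 exceeds the exponent 9 and the factor 2 obtained
     for large sums. *)
  exists 12, (/ 10), (fun x => Rmin x (/ 1000)).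
  split; [lra|]. split; [lra|]. split; [intros x Hx; apply Rmin_pos; lra|].
  intros k1 k2 k3 Hk3 Hk2 Hk1 beta mu Hb Hb2 _ _ Hmu He He2.
  assert (k2 <= / 1000) by (eapply Rle_trans; [apply Hk2|apply Rmin_r]).
  assert (k1 <= / 1000) by (eapply Rle_trans; [apply Hk1|apply Rmin_r]).
  assert (k1 <= k2) by (eapply Rle_trans; [apply Hk1|apply Rmin_l]).
  destruct (minor_arc_bound beta mu k1 Hb Hb2 Hmu He He2 ltac:(lra)) as (Y1 & G1 & HY1).
  destruct (major_arc_asymptotic beta mu k1 k2 k3 Hb Hmu He ltac:(lra) ltac:(lra) ltac:(lra)) as (Y2 & G2 & HY2).
  exists (Rpower (Y1 + Y2) mu). intros X theta HX delta1 delta2 delta3.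
  assert (X0 : 0 < X) by (eapply Rlt_le_trans; [apply Rpower_pos|exact HX]).
  set (Y := Rpower X (/ mu)).
  assert (EX : X = Rpower Y mu) by (unfold Y; rewrite Rpower_mult, Rinv_l, Rpower_1; lra).
  assert (HY : Y1 + Y2 <= Y).
  { unfold Y. apply Rle_trans with (Rpower (Rpower (Y1 + Y2) mu) (/ mu)).
    - rewrite Rpower_mult, Rinv_r, Rpower_1; lra.
    - apply Rle_Rpower_l; [left; apply Rinv_0_lt_compat; lra|]. split; [apply Rpower_pos|exact HX]. }
  (* In terms of Y every delta_i^s is Y^(-k_i s), free of mu. *)
  assert (Ed : forall k s, Rpower (Rpower X (- k / mu)) s = Rpower Y (- (k * s))).
  { intros k s. unfold Y. rewrite !Rpower_mult. f_equal. field; lra. }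
  unfold major_arc, delta1, delta2, delta3. rewrite !Ed.
  replace (- (k1 * (1 / 2))) with (- (k1 / 2)) by field.
  replace (- (k3 * (1 / 2))) with (- (k3 / 2)) by field.
  replace (- (k1 * - (12))) with (12 * k1) by ring.
  replace (- (k2 * - (12))) with (12 * k2) by ring.
  clearbody Y. subst X.
  assert (Pm : forall s t, s <= t -> Rpower Y s <= Rpower Y t) by (intros; apply Rle_Rpower; lra).
  assert (Pp := Rpower_pos Y).
  split.
  - destruct (HY1 Y theta ltac:(lra)) as [L|(a & q & Hq & Q & T)]; [left|right].
    + assert (P := Pp (- (k1 / 2))). lra.
    + exists a, q, (theta - IZR a / IZR q). split; [ring|]. split; [assumption|]. split.
      * assert (Rpower Y (9 * k1 / 2) <= Rpower Y (12 * k1)) by (apply Pm; lra).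
        assert (P := Pp (12 * k1)). lra.
      * eapply Rle_trans; [exact T|]. unfold Rdiv. apply Rmult_le_compat_r.
        { left; apply Rinv_0_lt_compat, pow_lt, Pp. }
        assert (Rpower Y (9 * k1) <= Rpower Y (12 * k2)) by (apply Pm; lra).
        assert (P := Pp (12 * k2)). lra.
  - intros a q t (Eth & Hq & Q & T) Hg.
    apply (HY2 Y theta a q t); try assumption; lra.
Qed.
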